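(* Let $\mathfrak g$ be a finite-dimensional complex simple Lie algebra and let $\mathfrak L(\mathfrak g)$ be the associated affine-Virasoro Lie algebra. Then every symmetric biderivation of $\mathfrak L(\mathfrak g)$ is trivial; that is, if $F$ is a symmetric biderivation of $\mathfrak L(\mathfrak g)$, then $F(x,y)=0$ for all $x,y\in\mathfrak L(\mathfrak g)$.
   Context: All vector spaces, algebras and tensor products are over $\mathbb C$. Let $(\cdot,\cdot)$ be the Killing form of $\mathfrak g$. The affine-Virasoro Lie algebra is the vector space $\mathfrak L(\mathfrak g)=(\mathfrak g\otimes\mathbb C[t^{\pm1}])\oplus\mathbb C K_1\oplus\mathbb C K_2\oplus\bigoplus_{m\in\mathbb Z}\mathbb C d_m$ with brackets, for $x,y\in\mathfrak g$, $m,n\in\mathbb Z$: $[x\otimes t^m,y\otimes t^n]=[x,y]\otimes t^{m+n}+m(x,y)\delta_{m+n,0}K_1$; $[\mathfrak L(\mathfrak g),K_1]=[\mathfrak L(\mathfrak g),K_2]=0$; $[d_m,x\otimes t^n]=n\,x\otimes t^{m+n}$; $[d_m,d_n]=(n-m)d_{m+n}+\delta_{m+n,0}\frac{m^3-m}{12}K_2$. A biderivation of a Lie algebra $L$ is a bilinear map $F:L\times L\to L$ such that for all $x,y,z\in L$: $F([x,y],z)=[x,F(y,z)]-[y,F(x,z)]$ and $F(x,[y,z])=[y,F(x,z)]-[z,F(x,y)]$. It is symmetric if $F(x,y)=F(y,x)$ for all $x,y\in L$. *)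

(* Defs.v *)
From HB Require Import structures.
From mathcomp Require Import all_boot all_order all_algebra.
From mathcomp Require Import finmap.
From mathcomp Require Import reals.
From mathcomp Require Export complex.
From mathcomp Require Import ring zify.

Set Implicit Arguments.
Unset Strict Implicit.
Unset Printing Implicit Defensive.

Import Order.TTheory GRing.Theory Num.Theory passmx.
Local Open Scope ring_scope.

HB.mixin Record Lmodule_isLie (K : fieldType) L of GRing.Lmodule K L := {
  lie : L -> L -> L;
  lie_bilinear_subproof : bilinear_for *:%R *:%R lie;
  liexx : forall x, lie x x = 0;
  lie_jacobi : forall x y z,
    lie x (lie y z) + lie y (lie z x) + lie z (lie x y) = 0
}.

#[short(type="lieType")]
HB.structure Definition Lie (K : fieldType) :=
  {L of Lmodule_isLie K L & GRing.Lmodule K L}.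

(* Finite-dimensional Lie algebras. *)
#[short(type="vectLieType")]
HB.structure Definition VectLie (K : fieldType) := {L of Lie K L & Vector K L}.

HB.instance Definition _ (K : fieldType) (L : lieType K) :=
  bilinear_isBilinear.Build K L L L *:%R *:%R (@lie K L)
    (@lie_bilinear_subproof K L).

Notation "[ 'lie' x , y ]" := (lie x y)
  (at level 0, x at level 99, y at level 99, format "[ 'lie'  x ,  y ]")
  : ring_scope.

Section LieTheory.
Variables (K : fieldType) (L : lieType K).
Implicit Types x y z : L.

Lemma lie0x x : [lie 0, x] = 0. Proof. exact: linear0l. Qed.
Lemma liex0 x : [lie x, 0] = 0. Proof. exact: linear0r. Qed.
Lemma lieDl x y z : [lie x + y, z] = [lie x, z] + [lie y, z].
Proof. exact: linearDl. Qed.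
Lemma lieDr x y z : [lie x, y + z] = [lie x, y] + [lie x, z].
Proof. exact: linearDr. Qed.
Lemma lieNl x y : [lie - x, y] = - [lie x, y].
Proof. exact: linearNl. Qed.
Lemma lieNr x y : [lie x, - y] = - [lie x, y].
Proof. exact: linearNr. Qed.
Lemma lieZl c x y : [lie c *: x, y] = c *: [lie x, y].
Proof. exact: linearZl_LR. Qed.
Lemma lieZr c x y : [lie x, c *: y] = c *: [lie x, y].
Proof. exact: linearZr_LR. Qed.

HB.instance Definition _ x := GRing.isLinear.Build K L L _ (lie x)
  ((@lie_bilinear_subproof K L).2 x).

Lemma lieC x y : [lie x, y] = - [lie y, x].
Proof.
have := liexx (x + y); rewrite lieDl !lieDr !liexx addr0 add0r.
by move/eqP; rewrite addr_eq0 => /eqP.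
Qed.

End LieTheory.

Lemma bilinear_forP (K : fieldType) (U V W : lmodType K) (f : U -> V -> W) :
  (forall z c x y, f (c *: x + y) z = c *: f x z + f y z) ->
  (forall z c x y, f z (c *: x + y) = c *: f z x + f z y) ->
  bilinear_for *:%R *:%R f.
Proof. by move=> fl fr; split=> [z c x y|z c x y]; [apply: fl|apply: fr]. Qed.

Section Simple.
Variables (K : fieldType) (g : vectLieType K).

Definition lie_ideal (I : {vspace g}) : Prop :=
  forall x y : g, y \in I -> [lie x, y] \in I.

Definition lie_simple : Prop :=
  (exists x y : g, [lie x, y] != 0) /\
  (forall I : {vspace g}, lie_ideal I -> I = 0%VS \/ I = fullv).

Definition ad (x : g) : 'End(g) := linfun (lie x).

(* The trace does not depend on the basis chosen to form the matrix. *)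
Definition killing (x y : g) : K :=
  let e := vbasis {:g} in \tr (mxof e e (ad x \o ad y)%VF).

Lemma adE x y : ad x y = [lie x, y].
Proof. by rewrite /ad lfunE. Qed.

Lemma ad_linear : linear ad.
Proof.
move=> c x y; apply/lfunP => z.
by rewrite add_lfunE scale_lfunE !adE lieDl lieZl.
Qed.

Lemma ad_lie x y : ad [lie x, y] = (ad x \o ad y)%VF - (ad y \o ad x)%VF.
Proof.
apply/lfunP => z; rewrite add_lfunE opp_lfunE !comp_lfunE !adE.
have /eqP := lie_jacobi x y z; rewrite (lieC z x) (lieC z) lieNr.
by rewrite subr_eq0 => /eqP.
Qed.

HB.instance Definition _ := GRing.isLinear.Build K _ _ _ ad ad_linear.

Local Notation e := (vbasis {:g}).

Lemma killingE x y : killing x y = \tr (mxof e e (ad y) *m mxof e e (ad x)).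
Proof. by rewrite /killing -(mxof_comp _ _ (vbasisP _)). Qed.

Lemma killing_bilinear : bilinear_for *%R *%R killing.
Proof.
split=> z c x y; rewrite !killingE !linearP /=.
  by [].
by rewrite mulmxDl -scalemxAl linearP.
Qed.

HB.instance Definition _ :=
  bilinear_isBilinear.Build K g g K *%R *%R killing killing_bilinear.

Lemma killingDl x y z : killing (x + y) z = killing x z + killing y z.
Proof. exact: linearDl. Qed.
Lemma killingDr x y z : killing x (y + z) = killing x y + killing x z.
Proof. exact: linearDr. Qed.
Lemma killingZl c x y : killing (c *: x) y = c * killing x y.
Proof. exact: linearZl_LR. Qed.
Lemma killingZr c x y : killing x (c *: y) = c * killing x y.
Proof. exact: linearZr_LR. Qed.

Lemma killingC x y : killing x y = killing y x.
Proof. by rewrite !killingE mxtrace_mulC. Qed.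

Lemma killing_invariant x y z : killing [lie x, y] z = killing x [lie y, z].
Proof.
rewrite !killingE !ad_lie ![mxof _ _ (_ - _)]linearB /=.
rewrite !(mxof_comp _ _ (vbasisP _)) mulmxBr mulmxBl ![\tr (_ - _)]linearB /=.
by rewrite !mulmxA; congr (_ - _); rewrite mxtrace_mulC mulmxA.
Qed.

End Simple.

(* [loop V] models V (x) K[t, t^-1]: the finitely supported function u stands
   for the sum of the u m (x) t^m. *)
Definition loop (K : fieldType) (V : lmodType K) := {fsfun int -> V with 0}.

Section Loop.
Variables (K : fieldType) (V : lmodType K).

HB.instance Definition _ := Choice.on (loop V).

Definition mono (m : int) (x : V) : loop V :=
  [fsfun i in [fset m]%fset => x | 0].

Definition loop0 : loop V := [fsfun with 0].
Definition loop_opp (u : loop V) : loop V :=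
  [fsfun i in finsupp u => - u i | 0].
Definition loop_add (u v : loop V) : loop V :=
  [fsfun i in (finsupp u `|` finsupp v)%fset => u i + v i | 0].
Definition loop_scale (c : K) (u : loop V) : loop V :=
  [fsfun i in finsupp u => c *: u i | 0].

Lemma monoE m x i : mono m x i = if i == m then x else 0.
Proof. by rewrite fsfunE inE. Qed.

Lemma loop_addE u v i : loop_add u v i = u i + v i.
Proof.
rewrite fsfunE inE; case: finsuppP => [ui|_] //=.
by case: finsuppP => [vi|//]; rewrite addr0.
Qed.

Lemma loop_oppE u i : loop_opp u i = - u i.
Proof. by rewrite fsfunE; case: finsuppP; rewrite ?oppr0. Qed.

Lemma loop_scaleE c u i : loop_scale c u i = c *: u i.
Proof.
by rewrite fsfunE; case: finsuppP; rewrite ?scaler0.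
Qed.

Fact loop_addA : associative loop_add.
Proof. by move=> u v w; apply/fsfunP => i; rewrite !loop_addE addrA. Qed.
Fact loop_addC : commutative loop_add.
Proof. by move=> u v; apply/fsfunP => i; rewrite !loop_addE addrC. Qed.
Fact loop_add0 : left_id loop0 loop_add.
Proof. by move=> u; apply/fsfunP => i; rewrite !loop_addE fsfunE add0r. Qed.
Fact loop_addN : left_inverse loop0 loop_opp loop_add.
Proof.
by move=> u; apply/fsfunP => i; rewrite loop_addE loop_oppE fsfunE addNr.
Qed.

HB.instance Definition _ := GRing.isZmodule.Build (loop V)
  loop_addA loop_addC loop_add0 loop_addN.

Fact loop_scaleA c d u : loop_scale c (loop_scale d u) = loop_scale (c * d) u.
Proof. by apply/fsfunP => i; rewrite !loop_scaleE scalerA. Qed.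
Fact loop_scale1 : left_id 1 loop_scale.
Proof. by move=> u; apply/fsfunP => i; rewrite loop_scaleE scale1r. Qed.
Fact loop_scaleDr : right_distributive loop_scale +%R.
Proof.
move=> c u v; apply/fsfunP => i.
by rewrite !(loop_scaleE, loop_addE) scalerDr.
Qed.
Fact loop_scaleDl u : {morph loop_scale^~ u : c d / c + d}.
Proof.
by move=> c d; apply/fsfunP => i; rewrite !(loop_scaleE, loop_addE) scalerDl.
Qed.

HB.instance Definition _ := GRing.Zmodule_isLmodule.Build K (loop V)
  loop_scaleA loop_scale1 loop_scaleDr loop_scaleDl.

Lemma loopDE (u v : loop V) i : (u + v) i = u i + v i.
Proof. exact: loop_addE. Qed.
Lemma loopZE c (u : loop V) i : (c *: u) i = c *: u i.
Proof. exact: loop_scaleE. Qed.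
Lemma loop0E i : (0 : loop V) i = 0.
Proof. by rewrite fsfunE. Qed.

Lemma mono_linear m : linear (mono m).
Proof.
move=> c x y; apply/fsfunP => i; rewrite loopDE loopZE !monoE.
by case: eqP; rewrite ?scaler0 ?addr0.
Qed.

HB.instance Definition _ m :=
  GRing.isLinear.Build K V (loop V) _ (mono m) (mono_linear m).

Lemma loop_sumE (I : Type) (r : seq I) (F : I -> loop V) i :
  (\sum_(k <- r) F k) i = \sum_(k <- r) F k i.
Proof.
by elim/big_rec2: _ => [|k y1 y2 _ <-]; rewrite ?loop0E ?loopDE.
Qed.

Lemma loop_monoE (u : loop V) : u = \sum_(m <- finsupp u) mono m (u m).
Proof.
apply/fsfunP => i; rewrite loop_sumE.
case: (finsuppP u i) => [iu|iu].
  rewrite big_seq big1 // => k ku; rewrite monoE; case: eqP => // ik.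
  by rewrite ik ku in iu.
rewrite (bigD1_seq i) //= monoE eqxx big1 ?addr0 // => k /negPf ki.
by rewrite monoE eq_sym ki.
Qed.

Lemma loop_ind (P : loop V -> Prop) :
  (forall u v, P u -> P v -> P (u + v)) -> (forall m x, P (mono m x)) ->
  forall u, P u.
Proof.
move=> PD Pm u; rewrite (loop_monoE u); elim/big_ind: _ => //.
by have <- : mono 0 0 = 0 :> loop V by rewrite linear0.
Qed.

End Loop.

(* Extension of a family of maps f m (x, y) on monomials x t^m, y t^n to a map
   on sums of monomials. *)
Definition lsum (K : fieldType) (V W : lmodType K) (f : int -> V -> W)
    (u : loop V) : W := \sum_(m <- finsupp u) f m (u m).

Definition lsum2 (K : fieldType) (U V W : lmodType K)
    (f : int -> int -> U -> V -> W) (u : loop U) (v : loop V) : W :=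
  lsum (fun m x => lsum (fun n y => f m n x y) v) u.

Section LsumTheory.
Variable K : fieldType.

Lemma lsumE (V W : lmodType K) (f : int -> V -> W) u (S : {fset int}) :
  (forall m, f m 0 = 0) -> (finsupp u `<=` S)%fset ->
  lsum f u = \sum_(m <- S) f m (u m).
Proof.
move=> f0 uS; rewrite /lsum [LHS](big_fset_incl _ uS) // => m _.
by case: finsuppP => // _; rewrite f0.
Qed.

Lemma linear_map0 (V W : lmodType K) (h : V -> W) : linear h -> h 0 = 0.
Proof.
by move=> hl; have := hl (-1) 0 0; rewrite !scaleN1r oppr0 addr0 addNr.
Qed.

Lemma lsum_linear (V W : lmodType K) (f : int -> V -> W) :
  (forall m, linear (f m)) -> linear (lsum f).
Proof.
move=> fl c u v.
have f0 m : f m 0 = 0 by apply: linear_map0 (fl m).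
pose S := (finsupp u `|` finsupp v `|` finsupp (c *: u + v)%R)%fset.
rewrite !(@lsumE _ _ f _ S) //; last 3 first.
- by rewrite /S fsubsetU // fsubsetUr.
- by rewrite /S fsubsetU // fsubsetUl.
- by rewrite /S fsubsetUr.
rewrite scaler_sumr -big_split /=; apply: eq_bigr => m _.
by rewrite loopDE loopZE fl.
Qed.

Lemma lsum_mono (V W : lmodType K) (f : int -> V -> W) m x :
  (forall n, f n 0 = 0) -> lsum f (mono m x) = f m x.
Proof.
move=> f0; rewrite (@lsumE _ _ f _ [fset m]%fset) //.
  by rewrite big_seq_fset1 monoE eqxx.
by apply/fsubsetP => i; rewrite mem_finsupp monoE inE; case: (i == m); rewrite ?eqxx.
Qed.

Variables (U V W : lmodType K) (f : int -> int -> U -> V -> W).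
Hypothesis fl : forall m n, bilinear_for *:%R *:%R (f m n).

Lemma lsum2_bilinear : bilinear_for *:%R *:%R (lsum2 f).
Proof.
split=> [v|u].
  apply: lsum_linear => m c a b.
  rewrite /lsum scaler_sumr -big_split /=; apply: eq_bigr => n _.
  exact: (fl m n).1.
suff: linear (lsum2 f u) by [].
move=> c a b; rewrite /lsum2 ![lsum _ u]/lsum scaler_sumr -big_split /=.
by apply: eq_bigr => m _; apply: lsum_linear => n; apply: (fl m n).2.
Qed.

Lemma lsum2_mono m x n y : lsum2 f (mono m x) (mono n y) = f m n x y.
Proof.
have f0r i j z : f i j z 0 = 0 by apply: linear_map0 ((fl i j).2 z).
have f0l i j z : f i j 0 z = 0 by apply: linear_map0 ((fl i j).1 z).
rewrite /lsum2 lsum_mono; first by rewrite lsum_mono.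
by move=> k; rewrite /lsum big1.
Qed.

Lemma lsum20 v : lsum2 f 0 v = 0.
Proof. exact: linear_map0 (lsum2_bilinear.1 v). Qed.

Lemma lsum2x0 u : lsum2 f u 0 = 0.
Proof. exact: linear_map0 (lsum2_bilinear.2 u). Qed.

End LsumTheory.

(* x = av_loop x + av_K1 x *: K_1 + av_K2 x *: K_2 + sum_m (av_vir x m) *: d_m *)
Record affvir (K : fieldType) (g : vectLieType K) := AffVir {
  av_loop : loop g;
  av_K1 : K^o;
  av_K2 : K^o;
  av_vir : loop K^o
}.

(* The operations and generators of [affvir] are locked to keep unification
   from unfolding them. *)
HB.lock Definition affvir0 (K : fieldType) (g : vectLieType K) : affvir g :=
  AffVir 0 0 0 0.
HB.lock Definition affvir_opp (K : fieldType) (g : vectLieType K)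
    (a : affvir g) : affvir g :=
  AffVir (- av_loop a) (- av_K1 a) (- av_K2 a) (- av_vir a).
HB.lock Definition affvir_add (K : fieldType) (g : vectLieType K)
    (a b : affvir g) : affvir g :=
  AffVir (av_loop a + av_loop b) (av_K1 a + av_K1 b) (av_K2 a + av_K2 b)
    (av_vir a + av_vir b).
HB.lock Definition affvir_scale (K : fieldType) (g : vectLieType K)
    (c : K) (a : affvir g) : affvir g :=
  AffVir (c *: av_loop a) (c *: av_K1 a) (c *: av_K2 a) (c *: av_vir a).

Section AffineVirasoroLmodule.
Variables (K : fieldType) (g : vectLieType K).
Implicit Types a b c : affvir g.

Definition affvir_tuple a := (av_loop a, av_K1 a, av_K2 a, av_vir a).
Definition tuple_affvir (t : loop g * K^o * K^o * loop K^o) : affvir g :=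
  let: (u, k1, k2, p) := t in AffVir u k1 k2 p.
Fact affvir_tupleK : cancel affvir_tuple tuple_affvir. Proof. by case. Qed.

HB.instance Definition _ := Choice.copy (affvir g) (can_type affvir_tupleK).

Lemma affvirP a b : av_loop a = av_loop b -> av_K1 a = av_K1 b ->
  av_K2 a = av_K2 b -> av_vir a = av_vir b -> a = b.
Proof. by case: a b => [? ? ? ?] [? ? ? ?] /= -> -> -> ->. Qed.

Fact affvir_addA : associative (@affvir_add K g).
Proof. by move=> a b c; rewrite affvir_add.unlock /= !addrA. Qed.
Fact affvir_addC : commutative (@affvir_add K g).
Proof.
move=> a b; rewrite affvir_add.unlock.
by congr AffVir; apply: addrC.
Qed.
Fact affvir_add0 : left_id (affvir0 g) (@affvir_add K g).
Proof.
by move=> a; apply: affvirP;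
  rewrite affvir_add.unlock affvir0.unlock /= add0r.
Qed.
Fact affvir_addN : left_inverse (affvir0 g) (@affvir_opp K g) (@affvir_add K g).
Proof.
by move=> a; apply: affvirP;
  rewrite affvir_add.unlock affvir0.unlock affvir_opp.unlock /= addNr.
Qed.

HB.instance Definition _ := GRing.isZmodule.Build (affvir g)
  affvir_addA affvir_addC affvir_add0 affvir_addN.

Fact affvir_scaleA (c d : K) a :
  affvir_scale c (affvir_scale d a) = affvir_scale (c * d) a :> affvir g.
Proof. by rewrite affvir_scale.unlock /= !scalerA. Qed.
Fact affvir_scale1 : left_id 1 (@affvir_scale K g).
Proof.
by move=> a; apply: affvirP; rewrite affvir_scale.unlock /= scale1r.
Qed.

Let addE : +%R = @affvir_add K g. Proof. by []. Qed.

Fact affvir_scaleDr : right_distributive (@affvir_scale K g) +%R.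
Proof.
move=> c a b.
by rewrite addE affvir_add.unlock affvir_scale.unlock /= !scalerDr.
Qed.
Fact affvir_scaleDl a : {morph (@affvir_scale K g)^~ a : c d / c + d}.
Proof.
move=> c d.
by rewrite addE affvir_add.unlock affvir_scale.unlock /= !scalerDl.
Qed.

HB.instance Definition _ := GRing.Zmodule_isLmodule.Build K (affvir g)
  affvir_scaleA affvir_scale1 affvir_scaleDr affvir_scaleDl.

Let scaleE : *:%R = @affvir_scale K g. Proof. by []. Qed.

Fact av_add a b : a + b =
  AffVir (av_loop a + av_loop b) (av_K1 a + av_K1 b) (av_K2 a + av_K2 b)
    (av_vir a + av_vir b).
Proof. by rewrite addE affvir_add.unlock. Qed.
Fact av_opp a :
  - a = AffVir (- av_loop a) (- av_K1 a) (- av_K2 a) (- av_vir a).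
Proof. by rewrite -[LHS]/(affvir_opp a) affvir_opp.unlock. Qed.
Fact av_scale (c : K) a :
  c *: a = AffVir (c *: av_loop a) (c *: av_K1 a) (c *: av_K2 a) (c *: av_vir a).
Proof. by rewrite scaleE affvir_scale.unlock. Qed.
Fact av_0 : 0 = AffVir 0 0 0 0 :> affvir g.
Proof. by rewrite -[LHS]/(affvir0 g) affvir0.unlock. Qed.

Lemma av_loop_linear : linear (@av_loop K g).
Proof.
by move=> k a b; rewrite av_add av_scale.
Qed.
Lemma av_K1_linear : linear (@av_K1 K g).
Proof.
by move=> k a b; rewrite av_add av_scale.
Qed.
Lemma av_K2_linear : linear (@av_K2 K g).
Proof.
by move=> k a b; rewrite av_add av_scale.
Qed.
Lemma av_vir_linear : linear (@av_vir K g).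
Proof.
by move=> k a b; rewrite av_add av_scale.
Qed.

HB.instance Definition _ :=
  GRing.isLinear.Build K (affvir g) (loop g) _ (@av_loop K g) av_loop_linear.
HB.instance Definition _ :=
  GRing.isLinear.Build K (affvir g) K^o _ (@av_K1 K g) av_K1_linear.
HB.instance Definition _ :=
  GRing.isLinear.Build K (affvir g) K^o _ (@av_K2 K g) av_K2_linear.
HB.instance Definition _ :=
  GRing.isLinear.Build K (affvir g) (loop K^o) _ (@av_vir K g) av_vir_linear.

End AffineVirasoroLmodule.

(* [xt x m] is x (x) t^m and [dd m] is d_m. *)
HB.lock Definition xt (K : fieldType) (g : vectLieType K) (x : g) (m : int)
  : affvir g := AffVir (mono m x) 0 0 0.
HB.lock Definition K1 (K : fieldType) (g : vectLieType K) : affvir g :=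
  AffVir 0 1 0 0.
HB.lock Definition K2 (K : fieldType) (g : vectLieType K) : affvir g :=
  AffVir 0 0 1 0.
HB.lock Definition dd (K : fieldType) (g : vectLieType K) (m : int)
  : affvir g := AffVir 0 0 0 (mono m (1 : K^o)).
Arguments xt {K g}.
Arguments K1 {K g}.
Arguments K2 {K g}.
Arguments dd {K g}.

Definition lie_xx (K : fieldType) (g : vectLieType K) (m n : int) (x y : g)
  : loop g := mono (m + n) [lie x, y].
Definition lie_xxK1 (K : fieldType) (g : vectLieType K) (m n : int) (x y : g)
  : K^o := if m + n == 0 then m%:~R * killing x y else 0.
Definition lie_dx (K : fieldType) (g : vectLieType K) (m n : int) (c : K^o)
  (x : g) : loop g := mono (m + n) ((n%:~R * c : K) *: x).
Definition lie_dd (K : fieldType) (m n : int) (c e : K^o) : loop K^o :=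
  mono (m + n) ((n - m)%:~R * (c * e) : K^o).
Definition lie_ddK2 (K : fieldType) (m n : int) (c e : K^o) : K^o :=
  if m + n == 0 then (m ^+ 3 - m)%:~R / 12%:R * (c * e) else 0.

HB.lock Definition affvir_lie (K : fieldType) (g : vectLieType K)
    (a b : affvir g) : affvir g :=
  AffVir
    (lsum2 (@lie_xx K g) (av_loop a) (av_loop b)
       + lsum2 (@lie_dx K g) (av_vir a) (av_loop b)
       - lsum2 (@lie_dx K g) (av_vir b) (av_loop a))
    (lsum2 (@lie_xxK1 K g) (av_loop a) (av_loop b))
    (lsum2 (@lie_ddK2 K) (av_vir a) (av_vir b))
    (lsum2 (@lie_dd K) (av_vir a) (av_vir b)).

Section AffineVirasoro.
Variables (K : fieldType) (g : vectLieType K).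

Let avE := (@av_add K g, @av_opp K g, @av_scale K g, @av_0 K g).

Fact lie_xx_bilinear m n : bilinear_for *:%R *:%R (@lie_xx K g m n).
Proof. by apply: bilinear_forP => z c x y; rewrite /lie_xx ?(lieDl, lieZl) ?(lieDr, lieZr) linearP. Qed.

Fact lie_xxK1_bilinear m n : bilinear_for *:%R *:%R (@lie_xxK1 K g m n).
Proof.
apply: bilinear_forP => z c x y; rewrite /lie_xxK1; case: eqP => _; rewrite ?scaler0 ?addr0 //.
  by rewrite killingDl killingZl /GRing.scale /=; ring.
by rewrite killingDr killingZr /GRing.scale /=; ring.
Qed.

Fact lie_dx_bilinear m n : bilinear_for *:%R *:%R (@lie_dx K g m n).
Proof.
apply: bilinear_forP => z c x y; rewrite /lie_dx -linearP /=; congr mono.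
  by rewrite scalerA -scalerDl /GRing.scale /=; congr (_ *: _); ring.
by rewrite scalerDr !scalerA mulrC.
Qed.

Fact lie_dd_bilinear m n : bilinear_for *:%R *:%R (@lie_dd K m n).
Proof.
by apply: bilinear_forP => z c x y; rewrite /lie_dd -linearP /=; congr mono;
  rewrite /GRing.scale /=; ring.
Qed.

Fact lie_ddK2_bilinear m n : bilinear_for *:%R *:%R (@lie_ddK2 K m n).
Proof.
by apply: bilinear_forP => z c x y; rewrite /lie_ddK2; case: eqP => _;
  rewrite ?scaler0 ?addr0 //; rewrite /GRing.scale /=; ring.
Qed.

Fact affvir_lie_bilinear : bilinear_for *:%R *:%R (@affvir_lie K g).
Proof.
have [xxl xxr] := lsum2_bilinear lie_xx_bilinear.
have [kl kr] := lsum2_bilinear lie_xxK1_bilinear.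
have [dxl dxr] := lsum2_bilinear lie_dx_bilinear.
have [ddl ddr] := lsum2_bilinear lie_dd_bilinear.
have [k2l k2r] := lsum2_bilinear lie_ddK2_bilinear.
have aux (c : K) (A A' B B' C C' : loop g) :
    c *: A + A' + (c *: B + B') - (c *: C + C') =
    c *: (A + B - C) + (A' + B' - C').
  rewrite !scalerDr scalerN opprD [RHS]addrACA.
  by rewrite (addrACA (c *: A)).
apply: bilinear_forP => [b c a a'|a c b b']; apply: affvirP;
  rewrite affvir_lie.unlock !avE /=.
- by rewrite xxl dxl dxr aux.
- by rewrite kl.
- by rewrite k2l.
- by rewrite ddl.
- by rewrite xxr dxr dxl aux.
- by rewrite kr.
- by rewrite k2r.
- by rewrite ddr.
Qed.

Let unl := (affvir_lie.unlock, xt.unlock, K1.unlock, K2.unlock, dd.unlock).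
Let simp := (add0r, addr0, subr0, sub0r, oppr0, scaler0, mulr1, mul1r).

Lemma xt_linear m : linear (fun x : g => xt x m).
Proof.
by move=> c x y; apply: affvirP;
  rewrite !avE xt.unlock /= ?scaler0 ?addr0 // linearP.
Qed.

Lemma xt0 m : xt 0 m = 0 :> affvir g.
Proof. exact: linear_map0 (xt_linear m). Qed.
Lemma xtD x y m : xt (x + y) m = xt x m + xt y m :> affvir g.
Proof. by have := xt_linear m 1 x y; rewrite !scale1r. Qed.
Lemma xtZ c x m : xt (c *: x) m = c *: xt x m :> affvir g.
Proof. by have := xt_linear m c x 0; rewrite xt0 !addr0. Qed.
Lemma xtN x m : xt (- x) m = - xt x m :> affvir g.
Proof. by rewrite -scaleN1r xtZ scaleN1r. Qed.

Lemma affvir_ind (P : affvir g -> Prop) :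
  (forall c a b, P a -> P b -> P (c *: a + b)) ->
  (forall x m, P (xt x m)) -> P K1 -> P K2 -> (forall m, P (dd m)) ->
  forall a, P a.
Proof.
move=> PP Px PK1 PK2 Pd a.
have P0 : P 0 by rewrite -(xt0 0).
have PD b c : P b -> P c -> P (b + c) by rewrite -{2}[b]scale1r; apply: PP.
have PZ c b : P b -> P (c *: b) by rewrite -[c *: b]addr0 => /PP; apply.
have -> : a = AffVir (av_loop a) 0 0 0 + (av_K1 a : K) *: K1
              + (av_K2 a : K) *: K2 + AffVir 0 0 0 (av_vir a).
  by apply: affvirP; rewrite !avE !unl /= ?simp //
    /GRing.scale /= mulr1.
apply: (PD); [apply: (PD); [apply: (PD)|]|]; try exact: PZ.
- elim/loop_ind: (av_loop a) => [v w Pv Pw|m x].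
    have -> : AffVir (v + w) 0 0 0 = AffVir v 0 0 0 + AffVir w 0 0 0.
      by apply: affvirP; rewrite !avE /= ?addr0.
    exact: PD.
  by have := Px x m; rewrite xt.unlock.
- elim/loop_ind: (av_vir a) => [v w Pv Pw|m c].
    have -> : AffVir 0 0 0 (v + w) =
        AffVir 0 0 0 v + AffVir 0 0 0 w :> affvir g.
      by apply: affvirP; rewrite !avE /= ?addr0.
    exact: PD.
  have -> : AffVir 0 0 0 (mono m c) = (c : K) *: (dd m : affvir g).
    apply: affvirP; rewrite !avE dd.unlock /= ?scaler0 //.
    by rewrite -linearZ /= /GRing.scale /= mulr1.
  exact: PZ.
Qed.

Local Notation br := (@affvir_lie K g).

Fact brDl a b c : br (a + b) c = br a c + br b c.
Proof.
by have := affvir_lie_bilinear.1 c 1 a b; rewrite /= !scale1r.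
Qed.
Fact brDr a b c : br a (b + c) = br a b + br a c.
Proof.
by have := affvir_lie_bilinear.2 a 1 b c; rewrite /= !scale1r.
Qed.
Fact br0l a : br 0 a = 0.
Proof. exact: linear_map0 (affvir_lie_bilinear.1 a). Qed.
Fact br0r a : br a 0 = 0.
Proof. exact: linear_map0 (affvir_lie_bilinear.2 a). Qed.
Fact brZl k a b : br (k *: a) b = k *: br a b.
Proof.
by have := affvir_lie_bilinear.1 b k a 0; rewrite /= br0l !addr0.
Qed.
Fact brZr k a b : br a (k *: b) = k *: br a b.
Proof.
by have := affvir_lie_bilinear.2 a k b 0; rewrite /= br0r !addr0.
Qed.

Let lsum2E := (
  (lsum2_mono lie_xx_bilinear, lsum20 lie_xx_bilinear, lsum2x0 lie_xx_bilinear),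
  (lsum2_mono lie_xxK1_bilinear, lsum20 lie_xxK1_bilinear,
   lsum2x0 lie_xxK1_bilinear),
  (lsum2_mono lie_dx_bilinear, lsum20 lie_dx_bilinear, lsum2x0 lie_dx_bilinear),
  (lsum2_mono lie_dd_bilinear, lsum20 lie_dd_bilinear, lsum2x0 lie_dd_bilinear),
  (lsum2_mono lie_ddK2_bilinear, lsum20 lie_ddK2_bilinear,
   lsum2x0 lie_ddK2_bilinear)).


Fact brK1 a : br a K1 = 0.
Proof.
by apply: affvirP; rewrite !avE !unl /= !lsum2E ?simp.
Qed.

Fact brK2 a : br a K2 = 0.
Proof.
by apply: affvirP; rewrite !avE !unl /= !lsum2E ?simp.
Qed.

Fact K1br a : br K1 a = 0.
Proof.
by apply: affvirP; rewrite !avE !unl /= !lsum2E ?simp.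
Qed.

Fact K2br a : br K2 a = 0.
Proof.
by apply: affvirP; rewrite !avE !unl /= !lsum2E ?simp.
Qed.

Fact br_xx x m y n : br (xt x m) (xt y n) =
  xt [lie x, y] (m + n) +
  (if m + n == 0 then m%:~R * killing x y else 0) *: K1.
Proof.
apply: affvirP; rewrite ?avE !unl /= !lsum2E ?simp //.
by rewrite /lie_xxK1 /GRing.scale /= mulr1.
Qed.

Fact br_dx m x n : br (dd m) (xt x n) = n%:~R *: xt x (m + n).
Proof.
apply: affvirP; rewrite ?avE !unl /= ?lsum2E ?simp //.
by rewrite /lie_dx mulr1 linearZ.
Qed.

Fact br_xd m x n : br (xt x n) (dd m) = - (n%:~R *: xt x (m + n)).
Proof.
apply: affvirP; rewrite ?avE !unl /= ?lsum2E ?simp //.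
by rewrite /lie_dx mulr1 linearZ.
Qed.

Fact br_dd m n : br (dd m) (dd n) =
  (n - m)%:~R *: dd (m + n) +
  (if m + n == 0 then (m ^+ 3 - m)%:~R / 12%:R else 0) *: K2.
Proof.
apply: affvirP; rewrite ?avE !unl /= ?lsum2E ?simp //.
  by rewrite /lie_ddK2 /GRing.scale /= !mulr1.
by rewrite /lie_dd !mulr1 -linearZ /=; congr mono; rewrite /GRing.scale /= mulr1.
Qed.

Let brE := (brDl, brDr, brZl, brZr, brK1, brK2, K1br, K2br,
            br_xx, br_dx, br_xd, br_dd).

Fact brC a b : br a b = - br b a.
Proof.
elim/affvir_ind: a => [c a a' IHa IHa'|x m|||m].
- by rewrite !(brDl, brDr, brZl, brZr) IHa IHa' scalerN opprD.
- elim/affvir_ind: b => [c b b' IHb IHb'|y n|||n].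
  + by rewrite !(brDl, brDr, brZl, brZr) IHb IHb' scalerN opprD.
  + rewrite !br_xx opprD -scaleNr lieC killingC (addrC n).
    congr (_ + _ *: _); first exact: xtN.
    case: eqP => [mn|_]; last by rewrite oppr0.
    by have -> : m = - n by [apply/eqP; rewrite -addr_eq0 mn]; rewrite mulrNz mulNr.
  + by rewrite brK1 K1br oppr0.
  + by rewrite brK2 K2br oppr0.
  + by rewrite br_xd br_dx.
- by rewrite brK1 K1br oppr0.
- by rewrite brK2 K2br oppr0.
- elim/affvir_ind: b => [c b b' IHb IHb'|y n|||n].
  + by rewrite !(brDl, brDr, brZl, brZr) IHb IHb' scalerN opprD.
  + by rewrite br_xd br_dx opprK.
  + by rewrite brK1 K1br oppr0.
  + by rewrite brK2 K2br oppr0.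
  + rewrite !br_dd opprD -!scaleNr (addrC n m).
    have -> : - (m - n)%:~R = (n - m)%:~R :> K by rewrite -mulrNz opprB.
    suff <- : (if m + n == 0 then (m ^+ 3 - m)%:~R / 12%:R else 0 : K) =
        - (if m + n == 0 then (n ^+ 3 - n)%:~R / 12%:R else 0) by [].
    case: eqP => [mn|_]; last by rewrite oppr0.
    have -> : m = - n by [apply/eqP; rewrite -addr_eq0 mn].
    by rewrite -mulNr -mulrNz; congr (_%:~R / _); ring.
Qed.

Fact br_alt a : br a a = 0.
Proof.
elim/affvir_ind: a => [c a b IHa IHb|x m|||m].
- rewrite !(brDl, brDr, brZl, brZr) IHa IHb (brC b a).
  by rewrite !scaler0 add0r addr0 scalerN subrr.
- rewrite br_xx liexx; case: eqP => [mm|_].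
    have -> : m = 0 by lia.
    by rewrite mul0r scale0r addr0 xt0.
  by rewrite scale0r addr0 xt0.
- exact: brK1.
- exact: brK2.
- rewrite br_dd subrr scale0r add0r; case: eqP => [mm|_]; last exact: scale0r.
  have -> : m = 0 by lia.
  by rewrite expr0n subrr mul0r scale0r.
Qed.

Let J a b c := br a (br b c) + br b (br c a) + br c (br a b).

Let J_cycle a b c : J a b c = J b c a.
Proof. by rewrite /J -addrA addrC. Qed.

Let J_lin k a a' b c : J (k *: a + a') b c = k *: J a b c + J a' b c.
Proof.
have aux (u v w u' v' w' : affvir g) :
    k *: u + u' + (k *: v + v') + (k *: w + w') =
    k *: (u + v + w) + (u' + v' + w').
  by rewrite !scalerDr [in RHS]addrACA [in RHS](addrACA (k *: u)).
by rewrite /J !(brDl, brDr, brZl, brZr) aux.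
Qed.

Let J_K1 a b : J K1 a b = 0.
Proof. by rewrite /J !(brK1, K1br, br0l, br0r) !addr0. Qed.

Let J_K2 a b : J K2 a b = 0.
Proof. by rewrite /J !(brK2, K2br, br0l, br0r) !addr0. Qed.

Let sum3 (x1 x2 x3 v : affvir g) (k1 k2 k3 : K) :
  x1 + k1 *: v + (x2 + k2 *: v) + (x3 + k3 *: v) =
  x1 + x2 + x3 + (k1 + k2 + k3) *: v.
Proof. by rewrite !scalerDl (addrACA x1) (addrACA (x1 + x2)). Qed.

Let J_xxx x m y n z p : J (xt x m) (xt y n) (xt z p) = 0.
Proof.
rewrite /J !(br_xx, brDr, brZr, brK1) !scaler0 !addr0.
have -> : n + (p + m) = m + (n + p) by ring.
have -> : p + (m + n) = m + (n + p) by ring.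
set s := m + (n + p).
have -> : killing y [lie z, x] = killing x [lie y, z].
  by rewrite -killing_invariant killingC.
have -> : killing z [lie x, y] = killing x [lie y, z].
  by rewrite killingC killing_invariant.
rewrite sum3.
have -> : xt [lie x, [lie y, z]] s + xt [lie y, [lie z, x]] s
        + xt [lie z, [lie x, y]] s = 0.
  by rewrite -!xtD lie_jacobi xt0.
rewrite add0r; case: eqP => [s0|_]; last by rewrite !addr0 scale0r.
rewrite -!mulrDl -!intrD -[m + n + p]addrA -/s s0 mul0r; exact: scale0r.
Qed.

Let J_xxd x m y n p : J (xt x m) (xt y n) (dd p) = 0.
Proof.
rewrite /J br_xd br_dx br_xx -scaleNr !(brDr, brZr, brK1, br_xx, br_dx).
have -> : m + (p + n) = p + (m + n) by ring.
have -> : n + (p + m) = p + (m + n) by ring.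
set s := p + (m + n).
have -> : xt [lie y, x] s = -1 *: xt [lie x, y] s.
  by rewrite lieC xtN scaleN1r.
rewrite (killingC y) !(scalerDr, scalerA) scaler0 addr0.
rewrite -[X in _ + _ + X]addr0 -[X in _ + (_ + X)](scale0r K1) sum3.
rewrite -!scalerDl [X in X *: xt _ _](_ : _ = 0) ?scale0r ?add0r; last by ring.
rewrite [X in X *: K1](_ : _ = 0) ?scale0r //.
by case: eqP => _; ring.
Qed.

Let J_xdd x m p q : J (xt x m) (dd p) (dd q) = 0.
Proof.
rewrite /J br_xd br_dx br_dd -scaleNr.
rewrite !(brDr, brZr, brK2, br_xd, br_dx) scaler0 addr0 -scaleNr !scalerA.
have -> : p + q + m = p + (q + m) by ring.
have -> : q + (p + m) = p + (q + m) by ring.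
by rewrite -!scalerDl [X in X *: _](_ : _ = 0) ?scale0r //; ring.
Qed.

Let J_ddd m n p : J (dd m) (dd n) (dd p) = 0.
Proof.
rewrite /J !(br_dd, brDr, brZr, brK2) !scaler0 !addr0 !scalerDr !scalerA.
have -> : n + (p + m) = m + (n + p) by ring.
have -> : p + (m + n) = m + (n + p) by ring.
set s := m + (n + p).
rewrite sum3 -!scalerDl.
rewrite [X in X *: dd _](_ : _ = 0) ?scale0r ?add0r; last by ring.
rewrite [X in X *: K2](_ : _ = 0) ?scale0r //.
case: eqP => [s0|_]; last by ring.
have -> : p = - (m + n) by apply/eqP; rewrite -addr_eq0 addrC -addrA -/s s0.
by ring.
Qed.

Fact br_jacobi a b c : br a (br b c) + br b (br c a) + br c (br a b) = 0.
Proof.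
rewrite -/(J a b c).
elim/affvir_ind: a b c => [k a a' IHa IHa'|x m|||m] b c.
- by rewrite J_lin IHa IHa' scaler0 addr0.
- rewrite J_cycle; elim/affvir_ind: b c => [k b b' IHb IHb'|y n|||n] c.
  + by rewrite J_lin IHb IHb' scaler0 addr0.
  + rewrite J_cycle; elim/affvir_ind: c => [k c c' IHc IHc'|z p|||p].
    * by rewrite J_lin IHc IHc' scaler0 addr0.
    * by rewrite J_cycle J_xxx.
    * exact: J_K1.
    * exact: J_K2.
    * by rewrite J_cycle J_xxd.
  + exact: J_K1.
  + exact: J_K2.
  + rewrite J_cycle; elim/affvir_ind: c => [k c c' IHc IHc'|z p|||p].
    * by rewrite J_lin IHc IHc' scaler0 addr0.
    * by rewrite J_xxd.
    * exact: J_K1.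
    * exact: J_K2.
    * by rewrite J_cycle J_xdd.
- exact: J_K1.
- exact: J_K2.
- rewrite J_cycle; elim/affvir_ind: b c => [k b b' IHb IHb'|y n|||n] c.
  + by rewrite J_lin IHb IHb' scaler0 addr0.
  + rewrite J_cycle; elim/affvir_ind: c => [k c c' IHc IHc'|z p|||p].
    * by rewrite J_lin IHc IHc' scaler0 addr0.
    * by rewrite -J_cycle J_xxd.
    * exact: J_K1.
    * exact: J_K2.
    * by rewrite -J_cycle J_xdd.
  + exact: J_K1.
  + exact: J_K2.
  + rewrite J_cycle; elim/affvir_ind: c => [k c c' IHc IHc'|z p|||p].
    * by rewrite J_lin IHc IHc' scaler0 addr0.
    * by rewrite J_xdd.
    * exact: J_K1.
    * exact: J_K2.
    * by rewrite J_cycle J_ddd.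
Qed.

HB.instance Definition _ := Lmodule_isLie.Build K (affvir g)
  affvir_lie_bilinear br_alt br_jacobi.

Lemma lie_xt_xt x m y n : [lie xt x m, xt y n] =
  xt [lie x, y] (m + n) +
  (if m + n == 0 then m%:~R * killing x y else 0) *: K1.
Proof. exact: br_xx. Qed.

Lemma lie_dd_xt m x n : [lie dd m, xt x n] = n%:~R *: xt x (m + n).
Proof. exact: br_dx. Qed.

Lemma lie_dd_dd m n : [lie dd m, dd n] =
  (n - m)%:~R *: dd (m + n) +
  (if m + n == 0 then (m ^+ 3 - m)%:~R / 12%:R else 0) *: K2.
Proof. exact: br_dd. Qed.

Lemma lie_K1 (a : affvir g) : [lie a, K1] = 0. Proof. exact: brK1. Qed.
Lemma lie_K2 (a : affvir g) : [lie a, K2] = 0. Proof. exact: brK2. Qed.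

End AffineVirasoro.

Section Biderivation.
Variables (K : fieldType) (L : lieType K).
Implicit Type F : {bilinear L -> L -> L}.

Definition biderivation F : Prop :=
  (forall x y z, F [lie x, y] z = [lie x, F y z] - [lie y, F x z]) /\
  (forall x y z, F x [lie y, z] = [lie y, F x z] - [lie z, F x y]).

Definition symmetric_map F : Prop := forall x y, F x y = F y x.

End Biderivation.

(* Main.v *)
Require Import Defs.
From HB Require Import structures.
From mathcomp Require Import all_boot all_order all_algebra.
From mathcomp Require Import finmap.
From mathcomp Require Import reals complex.
From mathcomp Require Import ring zify.

Set Implicit Arguments.
Unset Strict Implicit.
Unset Printing Implicit Defensive.

Import Order.TTheory GRing.Theory Num.Theory passmx.
Local Open Scope ring_scope.

(** Why the theorem holds.

    The operator ad d_0 grades the affine-Virasoro algebra by the integers.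
    Write D = F(d_0, .), and let pr_k be the projection to degree k.
    Expanding F([d_0, x], y) for x of degree n gives
      (k - n) pr_k F(x, y) = pr_k [x, D y],
    and the symmetry of F gives the same identity with x and y exchanged
    ([deg_part_biderivation]). Comparing the two yields, for x of degree n, y of
    degree m and n + p = m + q,
      q [x, pr_p (D y)] = p [y, pr_q (D x)]          ([deg_part_D_exchange]).
    With p = 0 this says that pr_0 (D y) commutes with almost all degrees, so it
    is central ([deg_part0_D_central]). Since D is a derivation, the degree 0
    part of D [x, d_{-p}] is therefore central too; the exchange identity
    turns this into centrality of (n + p) [d_{-p}, pr_p (D x)], which kills
    pr_p (D x) unless p = 0 or p = - n ([deg_part_D_eq0]). For a fixed shift
    p - n these exceptions only concern finitely many degrees n, and the algebra
    is generated by its elements of large degree ([graded_generation]); so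
    D = 0. Then the first identity makes F(x, y) homogeneous both of degree n and
    of degree m, hence zero when n and m differ, and a second appeal to generation
    in large degrees removes the case n = m.

    Two facts about the simple algebra g enter. Its centre is zero; and its
    Killing form is not zero, for otherwise K_1 would not be a bracket, and
    sending (K_1, K_1) to K_1 would give a nonzero symmetric biderivation. The
    latter is the relevant case of Cartan's criterion
    ([lie_simple_killing_neq0]), obtained as follows. Let x be in g and let delta
    act on each generalized eigenspace of ad x as the conjugate of the
    eigenvalue. Conjugation is additive, so delta is a derivation. If the
    Killing form vanishes, then y |-> tr(ad y . delta) vanishes on brackets, so
    its kernel is a nonzero ideal, and tr(ad x . delta) = 0. The
    eigenvalues of ad x . delta are the numbers |z|^2 for z an eigenvalue of
    ad x; being nonnegative with sum 0 they all vanish, so ad x is nilpotent.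
    As x is arbitrary, Engel's argument ([engel_fixed_vector]) gives a nonzero
    central element of g, a contradiction. *)

(** * Spectral theory of one matrix *)

Section Matrix.
Variable (F : closedFieldType).

Lemma ex_char_roots n (A : 'M[F]_n) :
  exists r : seq F, char_poly A = \prod_(z <- r) ('X - z%:P).
Proof.
have [r Er] := closed_field_poly_normal (char_poly A).
by exists r; rewrite [LHS]Er (monicP (char_poly_monic A)) scale1r.
Qed.

Lemma horner_mx_XsubC_exp n (A : 'M[F]_n.+1) (z : F) N :
  horner_mx A (('X - z%:P) ^+ N) = (A - z%:M) ^+ N.
Proof. by rewrite rmorphXn /= rmorphB /= horner_mx_X horner_mx_C. Qed.

(** The generalized eigenspaces span: stated as an induction principle, so that
    additive statements need only be checked on generalized eigenvectors,
    without choosing a decomposition. By Bezout, a vector killed by a product of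
    two coprime polynomials in A is a sum of vectors killed by each factor. *)
Lemma generalized_eigenvector_ind n (A : 'M[F]_n) : exists (r : seq F) (N : nat),
  (forall z, eigenvalue A z -> z \in r) /\
  forall P : 'rV[F]_n -> Prop, P 0 -> (forall v w, P v -> P w -> P (v + w)) ->
    (forall z v, z \in r -> v *m (A - z%:M) ^+ N = 0 -> P v) -> forall v, P v.
Proof.
have [r Er] := ex_char_roots A; exists r, (size r); split.
  by move=> z; rewrite eigenvalue_root_char Er root_prod_XsubC.
case: n => [|n] in A Er *; first by move=> P P0 _ _ v; rewrite thinmx0.
move=> P P0 PD Pg v; set N := size r.
have kill : v *m horner_mx A (\prod_(z <- undup r) ('X - z%:P) ^+ N) = 0.
  have: char_poly A %| \prod_(z <- undup r) ('X - z%:P) ^+ N.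
    rewrite Er -prodr_undup_exp_count.
    elim: (undup r) => [|z s IH]; first by rewrite !big_nil dvdpp.
    by rewrite !big_cons dvdp_mul // dvdp_exp2l // count_size.
  case/dvdpP => q ->; rewrite rmorphM /= Cayley_Hamilton mulr0; exact: mulmx0.
have: {subset undup r <= r} by move=> z; rewrite mem_undup.
elim: (undup r) (undup_uniq r) v kill => [|z s IH] /=.
  by move=> _ v; rewrite big_nil rmorph1 mulmx1 => ->.
move=> /andP[zs us] v; rewrite big_cons; set Q := \prod_(_ <- _) _ => vk sr.
have /Bezout_eq1_coprimepP [[u w] /= uw] : coprimep (('X - z%:P) ^+ N) Q.
  apply: coprimep_expl; rewrite coprimep_sym coprimep_XsubC /Q.
  elim: (s) zs => [|y t IHt]; first by rewrite big_nil root1.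
  rewrite inE negb_or big_cons => /andP[zy zt]; rewrite rootM negb_or IHt // andbT.
  apply: contra zy; rewrite /root horner_exp expf_eq0 => /andP[_].
  by rewrite hornerXsubC subr_eq0.
have -> : v = v *m horner_mx A (w * Q) + v *m horner_mx A (u * ('X - z%:P) ^+ N).
  by rewrite -mulmxDr -rmorphD /= [_ + _]addrC uw rmorph1 mulmx1.
apply: PD.
  apply: (Pg z); first by apply: sr; rewrite inE eqxx.
  rewrite -horner_mx_XsubC_exp -mulmxA mulmxE -rmorphM /=.
  have -> : w * Q * ('X - z%:P) ^+ N = ('X - z%:P) ^+ N * Q * w by ring.
  by rewrite rmorphM /= -mulmxE mulmxA vk mul0mx.
apply: IH => //; last by move=> y ys; apply: sr; rewrite inE ys orbT.
rewrite -mulmxA mulmxE -rmorphM /= -/Q.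
have -> : u * ('X - z%:P) ^+ N * Q = ('X - z%:P) ^+ N * Q * u by ring.
by rewrite rmorphM /= -mulmxE mulmxA vk mul0mx.
Qed.

(** Chinese remainders for the pairwise coprime moduli ('X - z) ^+ N. *)
Lemma interpolation_exp (f : F -> F) (r : seq F) N :
  exists p : {poly F}, forall z, z \in r -> ('X - z%:P) ^+ N %| p - (f z)%:P.
Proof.
elim: r => [|z r [p Hp]]; first by exists 0.
have [zr|zr] := boolP (z \in r).
  by exists p => y; rewrite inE => /orP[/eqP->|]; apply: Hp.
pose Q : {poly F} := (\prod_(y <- r) ('X - y%:P)) ^+ N.
have QP y : y \in r -> ('X - y%:P) ^+ N %| Q.
  by move=> yr; rewrite dvdp_exp2r // dvdp_XsubCl root_prod_XsubC.
have /Bezout_eq1_coprimepP [[u w] /= uw] : coprimep (('X - z%:P) ^+ N) Q.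
  apply/coprimep_expl/coprimep_expr.
  by rewrite coprimep_sym coprimep_XsubC root_prod_XsubC.
exists (p * (u * ('X - z%:P) ^+ N) + (f z)%:P * (w * Q)) => y.
rewrite inE => /orP[/eqP->|yr].
  have -> : p * (u * ('X - z%:P) ^+ N) + (f z)%:P * (w * Q) - (f z)%:P =
     (p * u - (f z)%:P * u) * ('X - z%:P) ^+ N.
    rewrite -[X in _ - X = _]mulr1 -uw; ring.
  exact: dvdp_mull.
have -> : p * (u * ('X - z%:P) ^+ N) + (f z)%:P * (w * Q) - (f y)%:P =
     (p - (f y)%:P) + ((f z)%:P * w - p * w) * Q.
  rewrite -[p in RHS]mulr1 -[X in p * X - _ + _]uw; ring.
by rewrite dvdp_add ?Hp // dvdp_mull // QP.
Qed.

(** A function of the eigenvalue can be realized on the generalized eigenspaces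
    by a polynomial in A, hence by a matrix commuting with A. The values in r
    need not be eigenvalues, and N is free: both matter for brackets, whose
    eigenvalues are sums and whose exponents add up. *)
Lemma ex_spectral_map n (A : 'M[F]_n) (f : F -> F) (r : seq F) N :
  exists D : 'M[F]_n, comm_mx A D /\
    forall z (v : 'rV_n), z \in r -> v *m (A - z%:M) ^+ N = 0 -> v *m D = f z *: v.
Proof.
case: n => [|n] in A *.
  by exists 0; split=> [|z v _ _]; rewrite ?thinmx0 //; apply/matrixP; case.
have [p Hp] := interpolation_exp f r N; exists (horner_mx A p); split.
  exact: comm_mx_horner.
move=> z v /Hp /dvdpP[q /eqP]; rewrite subr_eq => /eqP -> vz.
rewrite rmorphD rmorphM /= horner_mx_C horner_mx_XsubC_exp mulmxDr mul_mx_scalar.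
rewrite -horner_mx_XsubC_exp (comm_horner_mx2 A q) -mulmxE mulmxA.
by rewrite horner_mx_XsubC_exp vz mul0mx add0r.
Qed.

(** The polynomials in A preserve the c-eigenspace of B; multiplying a vector by
    the linear factors of the characteristic polynomial of A one at a time, the
    last nonzero vector is an eigenvector of A. *)
Lemma comm_mx_eigenvector n (A B : 'M[F]_n) c : comm_mx A B -> eigenvalue B c ->
  exists z (w : 'rV_n), [/\ w != 0, w *m A = z *: w & w *m B = c *: w].
Proof.
case: n => [|n] in A B *; first by move=> _ /eigenvalueP[v _]; rewrite (thinmx0 v) eqxx.
move=> AB /eigenvalueP[v vB v0]; have [r Er] := ex_char_roots A.
have: v *m horner_mx A (\prod_(z <- r) ('X - z%:P)) = 0.
  by rewrite -Er Cayley_Hamilton mulmx0.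
elim: r {Er} => [|z r IH] in v vB v0 *.
  by rewrite big_nil rmorph1 mulmx1 => v00; rewrite v00 eqxx in v0.
rewrite big_cons rmorphM /= rmorphB /= horner_mx_X horner_mx_C -mulmxE mulmxA.
have [vz _|vz] := eqVneq (v *m (A - z%:M)) 0.
  exists z, v; split=> //; apply/eqP; rewrite -subr_eq0 -mul_mx_scalar -mulmxBr.
  exact/eqP.
apply: IH => //; rewrite -mulmxA mulmxBl AB -scalar_mxC -mulmxBr mulmxA vB.
by rewrite scalemxAl.
Qed.

Lemma nilpotent_eigenvalue0 n (A : 'M[F]_n) :
  (forall z, eigenvalue A z -> z = 0) -> A ^+ n = 0.
Proof.
move=> A0; case: n => [|n] in A A0 *; first by apply/matrixP; case.
have [r Er] := ex_char_roots A.
have r0 z : z \in r -> z = 0.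
  by move=> zr; apply: A0; rewrite eigenvalue_root_char Er root_prod_XsubC.
have sr : size r = n.+1.
  by apply/eqP; rewrite -eqSS -(size_prod_XsubC r id) -Er size_char_poly.
have Ex : char_poly A = 'X ^+ n.+1.
  rewrite Er -sr big_seq (eq_bigr (fun=> 'X)) => [|z /r0->]; last by rewrite subr0.
  by rewrite -big_seq big_const_seq count_predT -Monoid.iteropE.
by have := Cayley_Hamilton A; rewrite Ex rmorphXn /= horner_mx_X.
Qed.

End Matrix.

Lemma eigenvalue_ge0_trace0 (C : numClosedFieldType) n (A : 'M[C]_n) :
  \tr A = 0 -> (forall z, eigenvalue A z -> 0 <= z) ->
  forall z, eigenvalue A z -> z = 0.
Proof.
move=> trA Age0 z; case: n => [|n] in A trA Age0 *.
  by case/eigenvalueP => v _; rewrite (thinmx0 v) eqxx.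
have [r Er] := ex_char_roots A.
have sr : size r = n.+1.
  by apply/eqP; rewrite -eqSS -(size_prod_XsubC r id) -Er size_char_poly.
have /eqP : \sum_(y <- r) y = 0.
  apply: oppr_inj; rewrite -coefPn_prod_XsubC ?sr // -Er.
  by rewrite char_poly_trace ?trA.
rewrite big_seq psumr_eq0; last first.
  by move=> y yr; apply: Age0; rewrite eigenvalue_root_char Er root_prod_XsubC.
move=> /allP r0; rewrite eigenvalue_root_char Er root_prod_XsubC => zr.
by have := r0 z zr; rewrite zr => /eqP.
Qed.

(** * Engel's theorem and eigenspaces of ad x *)

Lemma lie_leibniz (K : fieldType) (L : lieType K) (x y z : L) :
  [lie x, [lie y, z]] = [lie [lie x, y], z] + [lie y, [lie x, z]].
Proof.
have /eqP := lie_jacobi x y z.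
rewrite -addrA addr_eq0 => /eqP ->.
by rewrite opprD addrC (lieC z x) lieNr opprK (lieC z) opprK.
Qed.

Section LieFacts.
Variables (K : fieldType) (g : vectLieType K).
Implicit Types (x y z u v w : g) (T U W : {vspace g}).

Lemma lieBl x y z : [lie x - y, z] = [lie x, z] - [lie y, z].
Proof. by rewrite lieDl lieNl. Qed.
Lemma lieBr x y z : [lie x, y - z] = [lie x, y] - [lie x, z].
Proof. by rewrite lieDr lieNr. Qed.

(** A central element spans an ideal. *)
Lemma lie_simple_centerless : lie_simple g ->
  forall z, (forall x, [lie x, z] = 0) -> z = 0.
Proof.
move=> [[x [y xy]] simple] z zC; case: (simple <[z]>%VS) => [a b|/eqP|Ez].
- by move=> /vlineP[c ->]; rewrite lieZr zC scaler0 mem0v.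
- by rewrite -subv0 -memvE memv0 => /eqP.
- have : y \in <[z]>%VS by rewrite Ez memvf.
  by case/vlineP=> c yE; rewrite yE lieZr zC scaler0 eqxx in xy.
Qed.

Definition lie_stable T U := forall t u, t \in T -> u \in U -> [lie t, u] \in U.

(** The common fixed vector of Engel's theorem for the action of T on W / U,
    phrased inside g to avoid quotients. *)
Definition engel_property T := forall U W, (U <= W)%VS -> ~~ (W <= U)%VS ->
  lie_stable T U -> lie_stable T W ->
  exists v, [/\ v \in W, v \notin U & forall t, t \in T -> [lie t, v] \in U].

(** Start from a vector fixed by T modulo U. Its iterates under x are fixed by T
    as well, since x normalizes T; the last one outside U is also fixed by x. *)
Lemma engel_property_add_line T x :
  (forall v, exists N, iter N (lie x) v = 0) ->
  (forall t, t \in T -> [lie t, x] \in T) ->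
  engel_property T -> engel_property (T + <[x]>)%VS.
Proof.
move=> xnil xT QT U W UW WU TU TW.
have Tl t : t \in T -> t \in (T + <[x]>)%VS by apply: subvP (addvSl _ _) t.
have xx : x \in (T + <[x]>)%VS by apply: subvP (addvSr _ _) _ (memv_line x).
have TU' : lie_stable T U by move=> t u /Tl; apply: TU.
have TW' : lie_stable T W by move=> t u /Tl; apply: TW.
have [v [vW vU vT]] := QT U W UW WU TU' TW'.
have iW N : iter N (lie x) v \in W by elim: N => //= N IH; apply: TW.
have iT N t : t \in T -> [lie t, iter N (lie x) v] \in U.
  elim: N t => [|N IH] t tT /=; first exact: vT.
  by rewrite lie_leibniz rpredD ?IH ?xT // TU // IH.
have exU : exists N, iter N (lie x) v \in U.
  by have [N Nv] := xnil v; exists N; rewrite Nv mem0v.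
case: (ex_minnP exU) => [[|N] NU Nmin]; first by rewrite NU in vU.
exists (iter N (lie x) v); split=> //.
  by apply/negP => /Nmin; rewrite ltnn.
move=> t /memv_addP[a aT [_ /vlineP[c ->] ->]].
by rewrite lieDl lieZl rpredD ?iT // rpredZ.
Qed.

(** Subalgebras with the Engel property are enlarged one line at a time: the
    property of T, applied to the action of T on g / T, provides an element
    outside T that normalizes T. *)
Lemma engel_fixed_vector : (forall x v, exists N, iter N (lie x) v = 0) ->
  (exists x : g, x != 0) -> exists2 v : g, v != 0 & forall t, [lie t, v] = 0.
Proof.
move=> nil [x0 x0n].
have step k : exists T, [/\ lie_stable T T, engel_property T &
    (k <= \dim T)%N \/ T = fullv].
  elim: k => [|k [T [TT QT [kT|Tf]]]].
  - exists 0%VS; split; first by move=> t u _; rewrite !memv0 => /eqP->; rewrite liex0.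
      move=> U W UW WU _ _; have [v vW vU] := subvPn WU.
      by exists v; split=> // t; rewrite memv0 => /eqP->; rewrite lie0x mem0v.
    by left.
  - have [Tf|Tf] := eqVneq T fullv; first by exists T; split=> //; right.
    have Tn : ~~ (fullv <= T)%VS by apply: contra Tf => fT; rewrite eqEsubv subvf.
    have fT : lie_stable T fullv by move=> *; apply: memvf.
    have [x [_ xT nx]] := QT T fullv (subvf _) Tn TT fT.
    exists (T + <[x]>)%VS; split.
    + have Tl t : t \in T -> t \in (T + <[x]>)%VS by apply: subvP (addvSl _ _) t.
      move=> t u /memv_addP[a aT [_ /vlineP[c ->] ->]].
      move=> /memv_addP[b bT [_ /vlineP[d ->] ->]].
      rewrite lieDl !lieDr !(lieZl, lieZr) liexx !scaler0 addr0.
      have xb : [lie x, b] \in T by rewrite lieC rpredN nx.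
      by apply/Tl; rewrite !rpredD ?rpredZ ?nx // TT.
    + exact: engel_property_add_line.
    + left; apply: leq_ltn_trans kT _.
      rewrite ltn_neqAle dimvS ?addvSl // andbT.
      rewrite (dimv_leqif_eq (addvSl _ _)); apply: contra xT => /eqP ->.
      exact: subvP (addvSr _ _) _ (memv_line x).
  - by exists T; split=> //; right.
have [T [TT QT TE]] := step (\dim {:g}).+1.
have {TE} Tf : T = fullv by case: TE => // kT; have := dimvS (subvf T); lia.
(* For T = g, W = g and U = 0 the Engel property is the claim. *)
subst T; have [||||v [_ v0 vT]] := QT 0%VS fullv.
- exact: sub0v.
- by apply/subvPn; exists x0; rewrite ?memvf // memv0.
- by move=> t u _; rewrite !memv0 => /eqP->; rewrite liex0.
- by move=> *; apply: memvf.
exists v; first by rewrite -memv0.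
by move=> t; apply/eqP; rewrite -memv0 vT ?memvf.
Qed.

Definition eigen_shift x c v := [lie x, v] - c *: v.

Lemma iter_eigen_shiftD x c k v w : iter k (eigen_shift x c) (v + w) =
  iter k (eigen_shift x c) v + iter k (eigen_shift x c) w.
Proof.
elim: k => //= k ->; rewrite /eigen_shift lieDr scalerDr opprD.
by rewrite addrACA.
Qed.

Lemma iter_eigen_shift0 x c k : iter k (eigen_shift x c) 0 = 0.
Proof. by elim: k => //= k ->; rewrite /eigen_shift liex0 scaler0 subr0. Qed.

Lemma eigen_shift_lie x c d v w : eigen_shift x (c + d) [lie v, w] =
  [lie eigen_shift x c v, w] + [lie v, eigen_shift x d w].
Proof.
rewrite /eigen_shift lie_leibniz lieBl lieBr lieZl lieZr scalerDl opprD.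
by rewrite addrACA.
Qed.

Lemma iter_eigen_shift_lie x c d k l v w :
  iter k (eigen_shift x c) v = 0 -> iter l (eigen_shift x d) w = 0 ->
  iter (k + l) (eigen_shift x (c + d)) [lie v, w] = 0.
Proof.
have [n] := ubnP (k + l); elim: n k l v w => // n IH [|k] [|l] v w kl.
- by move=> /= ->; rewrite lie0x.
- by move=> /= -> _; rewrite lie0x -iterS iter_eigen_shift0.
- by move=> _ /= ->; rewrite liex0 -iterS iter_eigen_shift0.
move=> vk wl; rewrite addSn iterSr eigen_shift_lie iter_eigen_shiftD.
rewrite IH //; last by rewrite -iterSr.
  rewrite add0r addnS -addSn IH // ?addSn -?iterSr //.
  by rewrite addSn addnS in kl *; lia.
Qed.

Local Notation e := (vbasis {:g}).
Local Notation mx x := (mxof e e (ad x)).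

Lemma rVof_ad x v : rVof e v *m mx x = rVof e [lie x, v].
Proof. by rewrite -rVof_app ?vbasisP // adE. Qed.

Lemma rVof_eigen_shift x c k v : rVof e v *m (mx x - c%:M) ^+ k =
  rVof e (iter k (eigen_shift x c) v).
Proof.
elim: k => [|k IH]; first by rewrite expr0 mulmx1.
rewrite exprSr -mulmxE mulmxA IH mulmxBr rVof_ad mul_mx_scalar /=.
by rewrite [in RHS]linearB [in RHS]linearZ.
Qed.

End LieFacts.

(** * Nonvanishing of the Killing form of a simple algebra *)

Section Cartan.
Variables (C : numClosedFieldType) (g : vectLieType C).
Implicit Types (x y z u v w : g).

Local Notation e := (vbasis {:g}).
Local Notation mx x := (mxof e e (ad x)).

(** The derivation delta that conjugates the eigenvalues of ad x. The identity
    delta [u, v] = [delta u, v] + [u, delta v] is checked on generalized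
    eigenvectors of eigenvalues c and d: [u, v] has eigenvalue c + d, and
    conjugation is additive. *)
Lemma ex_conj_derivation x : exists2 D : 'M[C]_(\dim {:g}),
  comm_mx (mx x) D /\
  (forall c (v : 'rV_(\dim {:g})), v != 0 -> v *m mx x = c *: v -> v *m D = c^* *: v) &
  let delta := hommx e e D in
  forall u v, delta [lie u, v] = [lie delta u, v] + [lie u, delta v].
Proof.
have [r [N [rP ind]]] := generalized_eigenvector_ind (mx x).
(* The value at c + d must be prescribed even where c + d is no eigenvalue of
   ad x; a bracket of vectors of exponent N has exponent N + N. *)
pose s := r ++ [seq c + d | c <- r, d <- r].
have [D [xD sD]] := ex_spectral_map (mx x) (fun c => c^*) s (N + N).
have sub c k (v : 'rV_(\dim {:g})) : c \in s -> (k <= N + N)%N ->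
    v *m (mx x - c%:M) ^+ k = 0 -> v *m D = c^* *: v.
  move=> cs kN vk; apply: sD => //.
  by rewrite -(subnKC kN) exprD -mulmxE mulmxA vk mul0mx.
exists D.
  split=> // c v v0 vx.
  have cr : c \in r by apply: rP; apply/eigenvalueP; exists v.
  have [N0|N0] := posnP N.
    suff vz : v = 0 by rewrite vz eqxx in v0.
    by apply: (ind (fun a => a = 0)) => // [a b -> ->|z a _];
      rewrite ?addr0 // N0 expr0 mulmx1.
  apply: (sub _ 1%N); first by rewrite mem_cat cr.
    by rewrite addn_gt0 N0.
  by rewrite expr1 mulmxBr vx mul_mx_scalar subrr.
move=> delta.
have deltaE c k v : c \in s -> (k <= N + N)%N -> iter k (eigen_shift x c) v = 0 ->
  delta v = c^* *: v.
  move=> cs kN vk; apply: (can_inj (rVofK (vbasisP _))).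
  rewrite -rVof_mul ?vbasisP // (sub c k) ?linearZ // rVof_eigen_shift vk.
  exact: linear0.
have gind (P : g -> Prop) : P 0 -> (forall v w, P v -> P w -> P (v + w)) ->
    (forall c v, c \in r -> iter N (eigen_shift x c) v = 0 -> P v) -> forall v, P v.
  move=> P0 PD Pg v; rewrite -(rVofK (vbasisP fullv) v).
  apply: (ind (fun a => P (vecof e a))) => [|a b Pa Pb|c a cr aN].
  - by rewrite linear0.
  - by rewrite linearD; apply: PD.
  - apply: (Pg c) => //; apply: (can_inj (rVofK (vbasisP _))).
    by rewrite -rVof_eigen_shift vecofK ?vbasisP // aN linear0.
move=> u v; elim/gind: u => [|u u' IH IH'|c u cr uc].
- by rewrite !(lie0x, linear0) addr0.
- by rewrite !(lieDl, linearD) /= IH IH' addrACA.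
elim/gind: v => [|v v' IH IH'|d v dr vd].
- by rewrite !(liex0, linear0) addr0.
- by rewrite !(lieDr, linearD) /= IH IH' addrACA.
rewrite (deltaE _ _ _ _ _ (iter_eigen_shift_lie uc vd)) //; last first.
  by rewrite mem_cat; apply/orP; right; apply: allpairs_f.
rewrite (deltaE c N u) ?(deltaE d N v) ?leq_addr ?mem_cat ?cr ?dr //.
by rewrite lieZl lieZr -scalerDl rmorphD.
Qed.

(** With ad (delta v) = [delta, ad v], the trace of ad [u, v] . delta is, up to
    sign, the Killing form of delta v and u. So the trace functional
    x |-> tr(ad x . delta) kills all brackets; its kernel is thus an ideal, and
    it is nonzero because g is not abelian. *)
Lemma killing0_trace_derivation (D : 'M[C]_(\dim {:g})) : lie_simple g ->
  (forall x y, killing x y = 0 :> C) ->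
  (forall u v, hommx e e D [lie u, v] = [lie hommx e e D u, v] + [lie u, hommx e e D v]) ->
  forall x, \tr (mx x *m D) = 0.
Proof.
move=> [[a [b ab]] simple] kill0 derD.
have mxB u v : mx [lie u, v] = mx v *m mx u - mx u *m mx v.
  by rewrite ad_lie linearB /= !(mxof_comp _ _ (vbasisP _)).
have mxD u : mx (hommx e e D u) = mx u *m D - D *m mx u.
  apply/row_matrixP => i; rewrite !rowE.
  rewrite -[delta_mx 0 i](vecofK (vbasisP fullv)) rVof_ad mulmxBr !mulmxA rVof_ad.
  rewrite !(rVof_mul (vbasisP fullv) (vbasisP fullv) D) rVof_ad -linearB; congr rVof.
  by rewrite derD addrK.
have tr0 u v : \tr (mx [lie u, v] *m D) = 0.
  have -> : \tr (mx [lie u, v] *m D) = - \tr (mx (hommx e e D v) *m mx u).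
    rewrite mxB mxD !mulmxBl ![\tr (_ - _)]linearB /= opprB; congr (_ - _).
      by rewrite mxtrace_mulC mulmxA.
    by rewrite -mulmxA mxtrace_mulC.
  by rewrite -killingE kill0 oppr0.
have phil : linear (fun x => \tr (mx x *m D) : C^o).
  by move=> c u v; rewrite !linearP /= mulmxDl -scalemxAl linearP.
pose phi : 'Hom(g, C^o) := linfun (HB.pack (fun x => \tr (mx x *m D) : C^o)
  (GRing.isLinear.Build C g C^o _ _ phil) : {linear g -> C^o}).
have phiE x : phi x = \tr (mx x *m D) by rewrite lfunE.
have lie_ker u v : [lie u, v] \in lker phi by rewrite memv_ker phiE tr0.
case: (simple (lker phi)) => [u v _||kf x]; first exact: lie_ker.
  by move=> k0; have := lie_ker a b; rewrite k0 memv0 (negPf ab).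
have : x \in lker phi by rewrite kf memvf.
by rewrite memv_ker phiE => /eqP.
Qed.

(** For w a common eigenvector of ad x and delta with ad x w = z w, the
    eigenvalue of ad x . delta is z z^* = |z|^2. All eigenvalues of ad x . delta
    arise in this way, and their sum is its trace. *)
Lemma killing0_ad_nilpotent : lie_simple g ->
  (forall x y, killing x y = 0 :> C) -> forall x v, exists N, iter N (lie x) v = 0.
Proof.
move=> simple kill0 x v; have [D [xD eigD] derD] := ex_conj_derivation x.
have tr0 := killing0_trace_derivation simple kill0 derD x.
have eig0 c : eigenvalue (mx x *m D) c -> c = 0.
  have comm : comm_mx (mx x) (mx x *m D).
    by rewrite /comm_mx -mulmxA xD.
  apply: (eigenvalue_ge0_trace0 tr0) => {}c /(comm_mx_eigenvector comm).
  move=> [z [w [w0 wx wc]]]; move: wc; rewrite mulmxA wx -scalemxAl (eigD z w) //.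
  rewrite scalerA => /eqP; rewrite -subr_eq0 -scalerBl scaler_eq0 (negPf w0) orbF.
  by rewrite subr_eq0 => /eqP <-; apply: mul_conjC_ge0.
exists (\dim {:g}); apply: (can_inj (rVofK (vbasisP fullv))).
have -> : iter (\dim {:g}) (lie x) v = iter (\dim {:g}) (eigen_shift x 0) v.
  by apply: eq_iter => w; rewrite /eigen_shift scale0r subr0.
rewrite -rVof_eigen_shift raddf0 subr0 nilpotent_eigenvalue0 ?mulmx0 ?linear0 //.
move=> z /eigenvalueP[w wx w0]; apply/eqP; rewrite -normr_eq0 -sqrf_eq0 normCK.
apply/eqP/eig0/eigenvalueP; exists w => //.
by rewrite mulmxA wx -scalemxAl (eigD z w) // scalerA.
Qed.

(** The case of Cartan's criterion that is relevant here: were the form zero,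
    all ad x would be nilpotent, and Engel's theorem would give a nonzero
    central element. *)
Lemma lie_simple_killing_neq0 : lie_simple g -> exists x y : g, killing x y != 0.
Proof.
move=> simple.
pose ks := [seq killing a b | a <- e, b <- e].
have [/allP k0|/allPn[_ /allpairsP[[a b] [_ _ ->]] ?]] := boolP (all (eq_op^~ 0) ks);
  last by exists a, b.
have kb (i j : 'I_(\dim {:g})) : killing e`_i e`_j = 0 :> C.
    by apply/eqP/k0/allpairs_f; apply: mem_nth; rewrite size_tuple.
have kill0 x y : killing x y = 0 :> C.
  rewrite (coord_vbasis (memvf x)) (coord_vbasis (memvf y)).
  rewrite linear_sumlz big1 // => i _ /=.
  rewrite killingZl linear_sumr /= big1 ?mulr0 // => j _.
  by rewrite killingZr kb mulr0.
have [a [b ab]] := simple.1.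
have [|v v0 vC] := engel_fixed_vector (killing0_ad_nilpotent simple kill0).
  by exists [lie a, b].
by rewrite (lie_simple_centerless simple vC) eqxx in v0.
Qed.

End Cartan.

(** * The grading of the affine-Virasoro algebra *)

Section Grading.
Variables (K : numFieldType) (g : vectLieType K).
Local Notation L := (affvir g).
Implicit Types (a b x y : L) (u v w : g) (k m n p : int).

Definition deg_part k a : L := xt (av_loop a k) k + (av_vir a k : K) *: dd k +
  (if k == 0 then (av_K1 a : K) *: K1 + (av_K2 a : K) *: K2 else 0).

Lemma deg_part_linear k : linear (deg_part k).
Proof.
move=> c a b; rewrite /deg_part !linearP /= !loopDE !loopZE xtD xtZ.
have E (X Y Z X' Y' Z' : L) : c *: (X + Y + Z) + (X' + Y' + Z') =
   (c *: X + X') + (c *: Y + Y') + (c *: Z + Z').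
  by rewrite !scalerDr (addrACA _ _ (X' + Y')) (addrACA (c *: X)).
rewrite E; congr (_ + _ + _); first by rewrite scalerDl scalerA.
case: eqP => _; last by rewrite scaler0 addr0.
by rewrite scalerDr !scalerDl !scalerA [RHS]addrACA.
Qed.
HB.instance Definition _ k := GRing.isLinear.Build K L L _ (deg_part k) (deg_part_linear k).

Let simp := (monoE, loop0E, if_same, scale0r, scale1r, xt0, add0r, addr0).

Lemma deg_part_xt k u m : deg_part k (xt u m) = if k == m then xt u m else 0.
Proof.
rewrite /deg_part; have -> : av_loop (xt u m) = mono m u by rewrite xt.unlock.
have -> : av_vir (xt u m) = 0 by rewrite xt.unlock.
have -> : av_K1 (xt u m) = 0 by rewrite xt.unlock.
have -> : av_K2 (xt u m) = 0 by rewrite xt.unlock.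
by rewrite !simp; case: eqP => [->|] //; rewrite !simp.
Qed.

Lemma deg_part_dd k m : deg_part k (dd m) = if k == m then dd m else 0.
Proof.
rewrite /deg_part; have -> : av_loop (dd m) = 0 :> loop g by rewrite dd.unlock.
have -> : av_vir (dd m : L) = mono m 1 by rewrite dd.unlock.
have -> : av_K1 (dd m : L) = 0 by rewrite dd.unlock.
have -> : av_K2 (dd m : L) = 0 by rewrite dd.unlock.
by rewrite !simp; case: eqP => [->|] //; rewrite !simp.
Qed.

Lemma deg_part_K1 k : deg_part k K1 = if k == 0 then K1 else 0.
Proof.
rewrite /deg_part; have -> : av_loop K1 = 0 :> loop g by rewrite K1.unlock.
have -> : av_vir (K1 : L) = 0 by rewrite K1.unlock.
have -> : av_K1 (K1 : L) = 1 by rewrite K1.unlock.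
have -> : av_K2 (K1 : L) = 0 by rewrite K1.unlock.
by rewrite !simp.
Qed.

Lemma deg_part_K2 k : deg_part k K2 = if k == 0 then K2 else 0.
Proof.
rewrite /deg_part; have -> : av_loop K2 = 0 :> loop g by rewrite K2.unlock.
have -> : av_vir (K2 : L) = 0 by rewrite K2.unlock.
have -> : av_K1 (K2 : L) = 0 by rewrite K2.unlock.
have -> : av_K2 (K2 : L) = 1 by rewrite K2.unlock.
by rewrite !simp.
Qed.

Lemma deg_part_idem k m a : deg_part k (deg_part m a) = if k == m then deg_part m a else 0.
Proof.
rewrite {2}/deg_part 2!linearD linearZ /= deg_part_xt deg_part_dd
  (fun_if (deg_part k)) linearD !linearZ /=.
rewrite deg_part_K1 deg_part_K2 linear0.
have [->|km] := eqVneq k m; first by rewrite /deg_part; case: (m == 0).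
rewrite scaler0 !add0r; case: (eqVneq m 0) => // m0; move: km; rewrite m0 => /negPf ->.
by rewrite !scaler0 addr0.
Qed.

Lemma deg_part_inj0 a : (forall k, deg_part k a = 0) -> a = 0.
Proof.
have zl : av_loop 0 = 0 :> loop g by exact: linear0.
have zv : av_vir (0 : L) = 0 by exact: linear0.
move=> pa0; have loop0 k : av_loop a k = 0.
  have := congr1 (fun b => av_loop b k) (pa0 k); rewrite /deg_part /=.
  rewrite [av_loop (_ + _)]linearD /= [av_loop (_ + _)]linearD /= [av_loop (_ *: _)]linearZ /=.
  rewrite xt.unlock dd.unlock /= scaler0 !loopDE zl.
  case: eqP => _; last by rewrite zl !simp eqxx => ->.
  rewrite [av_loop (_ + _)]linearD /= ![av_loop (_ *: _)]linearZ /=.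
  by rewrite K1.unlock K2.unlock /= !scaler0 !loopDE !simp eqxx => ->.
have vir0 k : av_vir a k = 0.
  have := congr1 (fun b => av_vir b k) (pa0 k); rewrite /deg_part /=.
  rewrite [av_vir (_ + _)]linearD /= [av_vir (_ + _)]linearD /= [av_vir (_ *: _)]linearZ /=.
  rewrite xt.unlock dd.unlock /= !loopDE loopZE zv.
  case: eqP => _; last by rewrite zv !simp eqxx /GRing.scale /= mulr1 => ->.
  rewrite [av_vir (_ + _)]linearD /= ![av_vir (_ *: _)]linearZ /=.
  by rewrite K1.unlock K2.unlock /= !scaler0 !loopDE !simp eqxx /GRing.scale /= mulr1 => ->.
have := pa0 0; rewrite /deg_part loop0 vir0 eqxx !simp => aK.
have K1E := congr1 (@av_K1 K g) aK; have K2E := congr1 (@av_K2 K g) aK.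
apply: affvirP.
- by rewrite zl; apply/fsfunP => k; rewrite loop0 loop0E.
- move: K1E; rewrite linearD !linearZ /= K1.unlock K2.unlock /= scaler0 addr0.
  by rewrite /GRing.scale /= mulr1.
- move: K2E; rewrite linearD !linearZ /= K1.unlock K2.unlock /= scaler0 add0r.
  by rewrite /GRing.scale /= mulr1.
- by rewrite zv; apply/fsfunP => k; rewrite vir0 loop0E.
Qed.

(** Homogeneity is phrased as an eigenvalue of ad d_0, because this is the form
    in which biderivations see it. *)
Definition homog n a := [lie dd 0, a] = n%:~R *: a.

Lemma homog_xt u n : homog n (xt u n).
Proof. by rewrite /homog lie_dd_xt add0r. Qed.

Lemma homog_dd n : homog n (dd n).
Proof.
rewrite /homog lie_dd_dd subr0 add0r expr0n subrr mul0r if_same.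
by rewrite scale0r addr0.
Qed.

Lemma homog_K1 : homog 0 K1. Proof. by rewrite /homog lie_K1 scale0r. Qed.
Lemma homog_K2 : homog 0 K2. Proof. by rewrite /homog lie_K2 scale0r. Qed.

Lemma homogD n a b : homog n a -> homog n b -> homog n (a + b).
Proof. by rewrite /homog lieDr scalerDr => -> ->. Qed.

Lemma homogZ n c a : homog n a -> homog n (c *: a).
Proof. by rewrite /homog lieZr => ->; rewrite !scalerA mulrC. Qed.

Lemma homog0 n : homog n 0. Proof. by rewrite /homog liex0 scaler0. Qed.

Lemma homog_lie n m a b : homog n a -> homog m b -> homog (n + m) [lie a, b].
Proof.
rewrite /homog => Ha Hb; rewrite lie_leibniz Ha Hb lieZl lieZr.
by rewrite -scalerDl intrD.
Qed.

Lemma homog_deg_part k a : homog k (deg_part k a).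
Proof.
rewrite /deg_part; apply: homogD.
  by apply: homogD; [exact: homog_xt|exact/homogZ/homog_dd].
case: eqP => [->|_]; last exact: homog0.
by apply: homogD; apply: homogZ; [exact: homog_K1|exact: homog_K2].
Qed.

Lemma deg_part_lie_dd0 k a : deg_part k [lie dd 0, a] = k%:~R *: deg_part k a.
Proof.
elim/affvir_ind: a => [c a b IHa IHb|u m|||m].
- by rewrite lieDr lieZr !linearP /= IHa IHb.
- rewrite (homog_xt u m) linearZ /= deg_part_xt; case: eqP => [->|_] //.
  by rewrite !scaler0.
- by rewrite lie_K1 linear0 deg_part_K1; case: eqP => [->|_]; rewrite ?scaler0 ?scale0r.
- by rewrite lie_K2 linear0 deg_part_K2; case: eqP => [->|_]; rewrite ?scaler0 ?scale0r.
- rewrite (homog_dd m) linearZ /= deg_part_dd; case: eqP => [->|_] //.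
  by rewrite !scaler0.
Qed.

(** The degree k part of a is an eigenvector of ad d_0 for k, and distinct
    integers are distinct in characteristic zero. *)
Lemma deg_part_homog n a k : homog n a -> deg_part k a = if k == n then a else 0.
Proof.
move=> Ha.
have off j : j != n -> deg_part j a = 0.
  move=> jn; have := deg_part_lie_dd0 j a; rewrite Ha linearZ /= => /eqP.
  rewrite -subr_eq0 -scalerBl scaler_eq0 -intrB intr_eq0 subr_eq0 eq_sym.
  by rewrite (negPf jn) => /eqP.
have [->|] := eqVneq k n; last exact: off.
apply/esym/eqP; rewrite -subr_eq0; apply/eqP/deg_part_inj0 => j.
rewrite linearB /= deg_part_idem; have [->|jn] := eqVneq j n; first exact: subrr.
by rewrite off // subr0.
Qed.

Lemma deg_part_lie n x k a : homog n x -> deg_part (n + k) [lie x, a] = [lie x, deg_part k a].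
Proof.
move=> Hx; have gen m b : homog m b -> deg_part (n + k) [lie x, b] = [lie x, deg_part k b].
  move=> Hb; rewrite (deg_part_homog _ (homog_lie Hx Hb)) (deg_part_homog _ Hb).
  by rewrite (inj_eq (addrI n)); case: eqP; rewrite ?liex0.
elim/affvir_ind: a => [c a b IHa IHb|u m|||m].
- by rewrite lieDr lieZr !linearP /= IHa IHb.
- exact: gen (homog_xt u m).
- exact: gen homog_K1.
- exact: gen homog_K2.
- exact: gen (homog_dd m).
Qed.

(** The elements of large degree generate the algebra. In degree n, write
    x t^n and d_n (for n nonzero) as brackets of d_q, for q large, with an element of
    degree n - q. In degree 0, the brackets [d_q, d_{-q}] = - 2 q d_0 +
    (q^3 - q) / 12 K_2 for two consecutive q separate d_0 from K_2, and
    [u t^q, v t^{-q}] gives K_1 as soon as the Killing form of u and v is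
    nonzero. *)
Lemma graded_generation (P : int -> L -> Prop) (N : int) :
  (exists u v, killing u v != 0) ->
  (forall n c a b, P n a -> P n b -> P n (c *: a + b)) ->
  (forall n m a b, P n a -> P m b -> P (n + m) [lie a, b]) ->
  (forall n u, N <= `|n| -> P n (xt u n)) ->
  (forall n, N <= `|n| -> P n (dd n)) ->
  [/\ forall n u, P n (xt u n), P 0 K1, P 0 K2 & forall n, P n (dd n)].
Proof.
move=> [u0 [v0 kuv]] Plin Plie Pxt Pdd.
have P0 n a : P n a -> P n 0.
  by move=> Pa; have := Plin n (-1) a a Pa Pa; rewrite scaleN1r addNr.
have PZ n c a : P n a -> P n (c *: a).
  by move=> Pa; have := Plin n c a 0 Pa (P0 n a Pa); rewrite addr0.
have PZK n c a : c != 0 -> P n (c *: a) -> P n a.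
  by move=> c0 /(PZ _ c^-1); rewrite scalerK.
have PDK n a b : P n (b + a) -> P n b -> P n a.
  by move=> Pab Pb; have := Plin n (-1) _ _ Pb Pab; rewrite scaleN1r addKr.
have Pxtall n u : P n (xt u n).
  pose m := `|n| + `|N| + 1.
  have := Plie _ _ _ _ (Pdd m _) (Pxt (n - m) u _); rewrite lie_dd_xt subrKC.
  by move=> H; apply: (PZK _ (n - m)%:~R); [rewrite intr_eq0|apply: H]; lia.
pose m : int := `|N| + 1.
have dd2 q : m <= q -> P 0 ((- (q + q))%:~R *: dd 0 + ((q ^+ 3 - q)%:~R / 12%:R) *: K2).
  move=> mq; have := Plie _ _ _ _ (Pdd q _) (Pdd (- q) _).
  by rewrite lie_dd_dd subrr eqxx -opprD; apply; lia.
(* The combination of the brackets for m and m + 1 in which d_0 cancels. *)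
have PK2 : P 0 K2.
  have := Plin 0 m%:~R _ _ (dd2 (m + 1) _) (PZ 0 (- (m + 1))%:~R _ (dd2 m _)).
  rewrite !scalerDr !scalerA addrACA -!scalerDl.
  have -> : m%:~R * (- (m + 1 + (m + 1)))%:~R +
      (- (m + 1))%:~R * (- (m + m))%:~R = 0 :> K by ring.
  have -> : m%:~R * (((m + 1) ^+ 3 - (m + 1))%:~R / 12%:R) +
      (- (m + 1))%:~R * ((m ^+ 3 - m)%:~R / 12%:R) =
      (m * (m + 1) * (m + m + 1))%:~R / 12%:R :> K by ring.
  rewrite scale0r add0r => H; apply: PZK (H _ _); try lia.
  by apply: mulf_neq0; [rewrite intr_eq0; nia|rewrite invr_eq0 pnatr_eq0].
split=> //.
- have := Plie _ _ _ _ (Pxt m u0 _) (Pxt (- m) v0 _).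
  rewrite lie_xt_xt subrr eqxx => H.
  apply: PZK (PDK _ _ _ (H _ _) (Pxtall 0 _)); try lia.
  by rewrite mulf_neq0 // intr_eq0; lia.
- move=> n; have [->|n0] := eqVneq n 0.
    have := dd2 m (lexx _); rewrite addrC => H.
    by apply: PZK (PDK _ _ _ H (PZ _ _ _ PK2)); rewrite intr_eq0; lia.
  pose q := `|n| + `|N| + 1.
  have := Plie _ _ _ _ (Pdd q _) (Pdd (n - q) _).
  rewrite lie_dd_dd subrKC (negPf n0) scale0r addr0 => H.
  by apply: (PZK _ (n - q - q)%:~R); [rewrite intr_eq0|apply: H]; lia.
Qed.


Lemma xt_inj0 u n : xt u n = 0 :> L -> u = 0.
Proof.
move/(congr1 (fun a : L => av_loop a n)); rewrite xt.unlock /= monoE eqxx => ->.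
by rewrite linear0 loop0E.
Qed.

Lemma dd_neq0 n : dd n != 0 :> L.
Proof.
apply/eqP => /(congr1 (fun a : L => av_vir a n)); rewrite dd.unlock /= monoE eqxx.
by rewrite linear0 loop0E => /eqP; rewrite oner_eq0.
Qed.

(** An element of degree 0 that commutes with all elements of one nonzero degree
    is in the span of K_1 and K_2: d_n detects the d_0-component, and v t^n detects w
    because g has no centre. *)
Lemma degree0_commute n w (c k1 k2 : K) : (forall u, (forall v, [lie v, u] = 0) -> u = 0) ->
  n != 0 -> let a : L := xt w 0 + c *: dd 0 + (k1 *: K1 + k2 *: K2) in
  [lie dd n, a] = 0 -> (forall v, [lie xt v n, a] = 0) -> w = 0 /\ c = 0.
Proof.
move=> centerless n0 a.
have n0K : n%:~R != 0 :> K by rewrite intr_eq0.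
have KE b : [lie b, a] = [lie b, xt w 0] + c *: [lie b, dd 0].
  by rewrite /a !lieDr !lieZr lie_K1 lie_K2 !scaler0 !addr0.
rewrite KE lie_dd_xt lie_dd_dd addr0 (negPf n0) !scale0r add0r addr0 sub0r scalerA.
move/eqP; rewrite scaler_eq0 (negPf (dd_neq0 n)) orbF mulf_eq0 rmorphN oppr_eq0.
rewrite (negPf n0K) orbF => /eqP c0 comm; split=> //; apply: centerless => v.
have := comm v; rewrite KE c0 scale0r addr0 lie_xt_xt addr0 (negPf n0) scale0r addr0.
exact: xt_inj0.
Qed.

(** * Symmetric biderivations *)

Section SymmetricBiderivation.
Hypothesis centerless : forall u, (forall v, [lie v, u] = 0) -> u = 0.
Hypothesis killing_nonzero : exists u v, killing u v != 0.
Variable F : {bilinear L -> L -> L}.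
Hypothesis bidF : biderivation F.
Hypothesis symF : symmetric_map F.

Local Notation D := (F (dd 0)).

(** The degree k part of F([d_0, x], y) = [d_0, F(x, y)] - [x, D y]. *)
Lemma deg_part_biderivation n x y k : homog n x ->
  (k - n)%:~R *: deg_part k (F x y) = deg_part k [lie x, D y].
Proof.
move=> Hx; have := congr1 (deg_part k) (bidF.1 (dd 0) x y).
rewrite linearB /= deg_part_lie_dd0.
rewrite Hx linearZl_LR linearZ /= intrB scalerBl => ->.
by rewrite opprB addrC subrK.
Qed.

(** Both sides are p q times the degree n + p part of F(x, y) = F(y, x). *)
Lemma deg_part_D_exchange n m p q x y : homog n x -> homog m y -> n + p = m + q ->
  q%:~R *: [lie x, deg_part p (D y)] = p%:~R *: [lie y, deg_part q (D x)].
Proof.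
move=> Hx Hy npmq; rewrite -(deg_part_lie _ _ Hx) -(deg_part_lie _ _ Hy).
rewrite -(deg_part_biderivation _ _ Hx) -(deg_part_biderivation _ _ Hy) -npmq symF !scalerA.
have -> : n + p - n = p by ring.
have -> : n + p - m = q by rewrite npmq; ring.
by rewrite mulrC.
Qed.

(** For p = 0 the right side of the exchange identity vanishes, so pr_0 (D y)
    commutes with every degree n other than m. *)
Lemma deg_part0_D_central m y : homog m y -> forall x, [lie x, deg_part 0 (D y)] = 0.
Proof.
move=> Hy; pose n := `|m| + 1.
have nm : (n - m)%:~R != 0 :> K by rewrite intr_eq0; lia.
have comm x : homog n x -> [lie x, deg_part 0 (D y)] = 0.
  move=> Hx; have := @deg_part_D_exchange n m 0 (n - m) x y Hx Hy _.
  rewrite addr0 subrKC scale0r => /(_ erefl) /eqP.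
  by rewrite scaler_eq0 (negPf nm) => /eqP.
have n0 : n != 0 by lia.
have := degree0_commute centerless n0 (comm _ (homog_dd n)) (fun v => comm _ (homog_xt v n)).
rewrite /deg_part => -[-> ->] x.
by rewrite xt0 scale0r !add0r lieDr !lieZr lie_K1 lie_K2 !scaler0 addr0.
Qed.

(** The degree 0 part of D [x, d_{-p}] = [x, D d_{-p}] - [d_{-p}, D x] is central,
    and by the exchange identity p times it is - (n + p) [d_{-p}, pr_p (D x)].
    If pr_p (D x) = z t^p + c d_p, that bracket is p z t^0 + 2 p c d_0 up to K_2,
    and its being central forces z = 0 and c = 0. *)
Lemma deg_part_D_eq0 n p x : homog n x -> p != 0 -> n + p != 0 -> deg_part p (D x) = 0.
Proof.
move=> Hx p0 np0; have Hy := homog_dd (- p).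
have pK : p%:~R != 0 :> K by rewrite intr_eq0.
have npK : (n + p)%:~R != 0 :> K by rewrite intr_eq0.
have central b : [lie b, [lie dd (- p), deg_part p (D x)]] = 0.
  have ex := @deg_part_D_exchange n (- p) (- n) p x (dd (- p)) Hx Hy _.
  have := congr1 (deg_part 0) (bidF.2 (dd 0) x (dd (- p))).
  rewrite linearB /=.
  have -> : deg_part 0 [lie x, D (dd (- p))] = [lie x, deg_part (- n) (D (dd (- p)))].
    by rewrite -(deg_part_lie _ _ Hx) subrr.
  have -> : deg_part 0 [lie dd (- p), D x] = [lie dd (- p), deg_part p (D x)].
    by rewrite -(deg_part_lie _ _ Hy) addNr.
  move/(congr1 ( *:%R p%:~R)); rewrite scalerBr ex; last by rewrite subrr addNr.
  rewrite -scalerBl -intrB -opprD => E.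
  have := deg_part0_D_central (homog_lie Hx Hy) b => /(congr1 ( *:%R p%:~R)).
  rewrite scaler0 -lieZr E lieZr => /eqP.
  by rewrite scaler_eq0 rmorphN oppr_eq0 (negPf npK) => /eqP.
have := homog_deg_part p (D x).
rewrite /deg_part (negPf p0) addr0; set z := av_loop _ _; set c := av_vir _ _ => _.
move: central; rewrite /deg_part (negPf p0) addr0 -/z -/c => central.
have E : [lie dd (- p), xt z p + c *: dd p] = xt (p%:~R *: z) 0 + (c * (p + p)%:~R) *: dd 0 +
   (0 *: K1 + (c * ((- p) ^+ 3 - - p)%:~R / 12%:R) *: K2) :> L.
  rewrite lieDr lieZr lie_dd_xt lie_dd_dd addNr eqxx xtZ opprK scalerDr !scalerA.
  by rewrite scale0r add0r addrA mulrA.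
rewrite E in central.
have [z0 c0] := degree0_commute centerless (oner_neq0 _) (central (dd 1))
  (fun v => central (xt v 1)).
move/eqP: z0; rewrite scaler_eq0 (negPf pK) => /eqP->.
move/eqP: c0; rewrite mulf_eq0 intr_eq0 => /orP[/eqP->|]; last by lia.
by rewrite xt0 scale0r addr0.
Qed.

(** For a fixed shift j, the exceptional degrees n = - j and 2 n = - j of the
    preceding lemma satisfy |n| <= |j|. Vanishing of the component of shift j is
    inherited by brackets, since D is a derivation. *)
Lemma D_eq0 y : D y = 0.
Proof.
have gen j : [/\ forall n u, deg_part (n + j) (D (xt u n)) = 0, deg_part (0 + j) (D K1) = 0,
    deg_part (0 + j) (D K2) = 0 & forall n, deg_part (n + j) (D (dd n)) = 0].
  pose P n a := homog n a /\ deg_part (n + j) (D a) = 0.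
  have [] := @graded_generation P (`|j| + 1) killing_nonzero.
  - move=> n c a b [Ha Pa] [Hb Pb]; split; first exact/homogD/Hb/homogZ.
    by rewrite linearP /= linearP /= Pa Pb scaler0 addr0.
  - move=> n m a b [Ha Pa] [Hb Pb]; split; first exact: homog_lie.
    rewrite bidF.2 linearB /= -[in X in X - _]addrA (deg_part_lie _ _ Ha) Pb.
    by rewrite (addrC n m) -addrA (deg_part_lie _ _ Hb) Pa !liex0 subr0.
  - move=> n u nj; split; first exact: homog_xt.
    by apply: deg_part_D_eq0 (homog_xt u n) _ _; lia.
  - move=> n nj; split; first exact: homog_dd.
    by apply: deg_part_D_eq0 (homog_dd n) _ _; lia.
  by move=> Px [_ PK1] [_ PK2] Pd; split=> // [n u|n]; [case: (Px n u)|case: (Pd n)].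
elim/affvir_ind: y => [c a b Da Db|u m|||m].
- by rewrite linearP /= Da Db scaler0 addr0.
- by apply: deg_part_inj0 => k; have [H _ _ _] := gen (k - m); rewrite -(H m u) subrKC.
- by apply: deg_part_inj0 => k; have [_ H _ _] := gen k; rewrite -H add0r.
- by apply: deg_part_inj0 => k; have [_ _ H _] := gen k; rewrite -H add0r.
- by apply: deg_part_inj0 => k; have [_ _ _ H] := gen (k - m); rewrite -(H m) subrKC.
Qed.

(** With D = 0, the components of F(x, y) vanish outside degree n, and by
    symmetry outside degree m. *)
Lemma biderivation_homog_eq0 n m x y : homog n x -> homog m y -> n != m -> F x y = 0.
Proof.
move=> Hx Hy nm; apply: deg_part_inj0 => k.
have := deg_part_biderivation y k Hx; rewrite D_eq0 liex0 linear0 => /eqP.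
rewrite scaler_eq0 intr_eq0 => /orP[kn|/eqP//].
have := deg_part_biderivation x k Hy; rewrite D_eq0 liex0 linear0 symF => /eqP.
rewrite scaler_eq0 intr_eq0 => /orP[km|/eqP//]; lia.
Qed.

(** For x of degree n, the elements y with F(x, y) = 0 form a subalgebra that
    contains every degree other than n. *)
Lemma symmetric_biderivation_eq0 x y : F x y = 0.
Proof.
have Fhom n a b : homog n a -> F a b = 0.
  move=> Ha; pose P (m : int) b := F a b = 0.
  have [] := @graded_generation P (`|n| + 1) killing_nonzero.
  - by move=> k c a' b'; rewrite /P linearP /= => -> ->; rewrite scaler0 addr0.
  - by move=> k m a' b'; rewrite /P bidF.2 => -> ->; rewrite !liex0 subr0.
  - by move=> m u mn; apply: biderivation_homog_eq0 Ha (homog_xt u m) _; lia.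
  - by move=> m mn; apply: biderivation_homog_eq0 Ha (homog_dd m) _; lia.
  move=> Px PK1 PK2 Pd; elim/affvir_ind: b => [c a' b' Pa Pb|u m|||m] //.
  - by rewrite linearP /= Pa Pb scaler0 addr0.
  - exact: Px m u.
  - exact: Pd m.
elim/affvir_ind: x => [c a b Fa Fb|u m|||m].
- by rewrite linearPl Fa Fb scaler0 addr0.
- exact: Fhom (homog_xt u m).
- exact: Fhom homog_K1.
- exact: Fhom homog_K2.
- exact: Fhom (homog_dd m).
Qed.

End SymmetricBiderivation.

End Grading.

Theorem theorem3p8 (R : realType) (g : vectLieType R[i]) (hg : lie_simple g)
    (F : {bilinear affvir g -> affvir g -> affvir g}) :
  biderivation F -> symmetric_map F -> forall x y : affvir g, F x y = 0.
Proof.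
move=> bidF symF; apply: symmetric_biderivation_eq0 => //.
  exact: lie_simple_centerless.
exact: lie_simple_killing_neq0.
Qed.
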